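(* Let $V$ be a Hilbert module over the Clifford algebra $\mathbb{R}_d$, let $T\in\mathcal{B}(V)$, and let $f\in\mathcal{SH}_L(U')$ or $f\in\mathcal{SH}_R(U')$ for some axially symmetric open set $U'\supseteq\sigma_S(T)$. Then the bounded $S$-functional calculi of $T^*$ and $T$ are connected via $$f(T^* )=f^\#(T)^*,\qquad f^\#(s):=\overline{f(\overline{s})}.$$ Here, if $f\in\mathcal{SH}_L(U')$, then $f(T^* )$ is the left bounded $S$-functional calculus and $f^\#(T)$ is the right bounded $S$-functional calculus (of $f^\#\in\mathcal{SH}_R(U')$); if $f\in\mathcal{SH}_R(U')$, then $f(T^* )$ is the right and $f^\#(T)$ the left bounded $S$-functional calculus (of $f^\#\in\mathcal{SH}_L(U')$). If moreover $f\in\mathcal{N}(U')$ is intrinsic, then $f(T^* )=f(T)^*$.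
   Context: Clifford algebra: for $d\in\mathbb{N}$, $d\ge1$, $\mathbb{R}_d$ is the real Clifford algebra generated by $e_1,\dots,e_d$ with $e_i^2=-1$, $e_ie_j=-e_je_i$ for $i\neq j$, with real basis $e_A=e_{i_1}\cdots e_{i_r}$, $A=(i_1,\dots,i_r)$, $1\le i_1<\dots<i_r\le d$, $e_\emptyset=1$. For $s=\sum_As_Ae_A$: $\overline{s}=\sum_A(-1)^{|A|(|A|+1)/2}s_Ae_A$, $|s|^2=\sum_As_A^2$. Paravectors: $\mathbb{R}^{d+1}=\{s_0+s_1e_1+\dots+s_de_d\}$, $\operatorname{Im}(s)=s_1e_1+\dots+s_de_d$. $\mathbb{S}=\{J\in\mathbb{R}^{d+1}\mid J_0=0,|J|=1\}$, $\mathbb{C}_J=\{x+Jy\mid x,y\in\mathbb{R}\}$, $[s]=\{s_0+J|\operatorname{Im}(s)|\mid J\in\mathbb{S}\}$; $U\subseteq\mathbb{R}^{d+1}$ is axially symmetric if $[s]\subseteq U$ for all $s\in U$. Slice hyperholomorphic functions: for $U$ open, axially symmetric, let $\mathcal{U}=\{(x,y)\in\mathbb{R}^2\mid x+\mathbb{S}y\subseteq U\}$. $f:U\to\mathbb{R}_d$ is in $\mathcal{SH}_L(U)$ (resp. $\mathcal{SH}_R(U)$) if there are $C^1$ functions $f_0,f_1:\mathcal{U}\to\mathbb{R}_d$ with $f(x+Jy)=f_0(x,y)+Jf_1(x,y)$ (resp. $f(x+Jy)=f_0(x,y)+f_1(x,y)J$) for all $J\in\mathbb{S}$, $f_0(x,-y)=f_0(x,y)$,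 $f_1(x,-y)=-f_1(x,y)$, $\partial_xf_0=\partial_yf_1$, $\partial_yf_0=-\partial_xf_1$. If $f_0,f_1$ are real valued, $f$ is intrinsic, $f\in\mathcal{N}(U)$. Hilbert module: for a real Hilbert space $V_\mathbb{R}$, $V=\{\sum_Av_A\otimes e_A\mid v_A\in V_\mathbb{R}\}$ with $\|v\|^2=\sum_A\|v_A\|_\mathbb{R}^2$, $sv=\sum_{A,B}(s_Bv_A)\otimes(e_Be_A)$, $vs=\sum_{A,B}(v_As_B)\otimes(e_Ae_B)$, $\langle v,w\rangle=\sum_{A,B}\langle v_A,w_B\rangle_\mathbb{R}\overline{e_A}e_B$. $\mathcal{B}(V)$ is the set of bounded everywhere defined right-linear operators; the adjoint $T^*\in\mathcal{B}(V)$ of $T\in\mathcal{B}(V)$ satisfies $\langle T^*w,v\rangle=\langle w,Tv\rangle$. Clifford numbers act on operators by left multiplication: $(sT)v=s(Tv)$, $(Ts)v=T(sv)$. $S$-spectrum: $Q_s[T]=T^2-2s_0T+|s|^2$, $\rho_S(T)=\{s\in\mathbb{R}^{d+1}\mid Q_s[T]^{-1}\in\mathcal{B}(V)\}$, $\sigma_S(T)=\mathbb{R}^{d+1}\setminus\rho_S(T)$ (one has $\sigma_S(T^* )=\sigma_S(T)$); $S_L^{-1}(s,T)=Q_s[T]^{-1}\overline{s}-TQ_s[T]^{-1}$, $S_R^{-1}(s,T)=(\overline{s}-T)Q_s[T]^{-1}$ for $s\in\rho_S(T)$. Bounded $S$-functional calculus: for $T\in\mathcal{B}(V)$ and $f\in\mathcal{SH}_L(U')$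 (resp. $f\in\mathcal{SH}_R(U')$), with $U'\supseteq\sigma_S(T)$ open and axially symmetric, $$f(T):=\frac{1}{2\pi}\int_{\partial U\cap\mathbb{C}_J}S_L^{-1}(s,T)\,ds_J\,f(s)\qquad\Big(\text{resp. }f(T):=\frac{1}{2\pi}\int_{\partial U\cap\mathbb{C}_J}f(s)\,ds_J\,S_R^{-1}(s,T)\Big),$$ where $J\in\mathbb{S}$ is arbitrary and $U$ is any bounded, axially symmetric open set with $\sigma_S(T)\subseteq U\subseteq\overline{U}\subseteq U'$ whose boundary is regular enough (e.g. $\partial U\cap\mathbb{C}_J$ is a finite union of piecewise $C^1$ Jordan curves), positively oriented in $\mathbb{C}_J$. Here $ds_J:=-J\,ds$, i.e. for a parametrization $\gamma$ of the path in $\mathbb{C}_J$ the integrand is $S_L^{-1}(\gamma(t),T)(-J\gamma'(t))f(\gamma(t))\,dt$ (resp. $f(\gamma(t))(-J\gamma'(t))S_R^{-1}(\gamma(t),T)\,dt$), integrated in operator norm. The value does not depend on $J$ and $U$, and for intrinsic $f$ the left and right versions coincide. *)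

(* Defs.v *)
From HB Require Import structures.
From mathcomp Require Import all_boot all_order all_algebra.
From mathcomp Require Import all_classical all_reals all_analysis.
Set Implicit Arguments. Unset Strict Implicit. Unset Printing Implicit Defensive.
Import Order.TTheory GRing.Theory Num.Theory.
Import numFieldNormedType.Exports.
Local Open Scope classical_set_scope.
Local Open Scope ring_scope.

(* The coordinate s A of s in R_d is the coefficient of the basis element    *)
(* e_A, where A is a subset of {0, .., d-1}.                                 *)
Definition clifford (R : realType) (d : nat) : Type := {ffun {set 'I_d} -> R}.

HB.instance Definition _ (R : realType) (d : nat) :=
  GRing.Lmodule.copy (clifford R d) {ffun {set 'I_d} -> R}.

Definition cbasis (R : realType) (d : nat) (A : {set 'I_d}) : clifford R d :=
  [ffun B => (B == A)%:R].

Definition symdiff (d : nat) (A B : {set 'I_d}) : {set 'I_d} :=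
  [set i | (i \in A) (+) (i \in B)]%SET.

(* e_A e_B = (-1)^n e_(A symdiff B): sorting the product costs one sign for  *)
(* each pair i in A, j in B with j < i, and e_i e_i = -1 one for each i = j. *)
Definition cinv (d : nat) (A B : {set 'I_d}) : nat :=
  #|[set p : 'I_d * 'I_d | [&& p.1 \in A, p.2 \in B & (p.2 <= p.1)%N]]%SET|.

Definition cmul (R : realType) (d : nat) (s t : clifford R d) : clifford R d :=
  \sum_A \sum_B ((-1) ^+ cinv A B * (s A * t B)) *: cbasis R (symdiff A B).

Lemma symdiffA (d : nat) : associative (@symdiff d).
Proof. by move=> A B C; apply/setP => i; rewrite !inE addbA. Qed.

Lemma symdiff0s (d : nat) : left_id finset.set0 (@symdiff d).
Proof. by move=> A; apply/setP => i; rewrite !inE. Qed.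

Lemma symdiffs0 (d : nat) : right_id finset.set0 (@symdiff d).
Proof. by move=> A; apply/setP => i; rewrite !inE addbF. Qed.

Lemma odd_cinv (d : nat) (A B : {set 'I_d}) :
  odd (cinv A B) =
  \big[addb/false]_i \big[addb/false]_j
     [&& i \in A, j \in B & (j <= i)%N].
Proof.
rewrite pair_bigA /cinv -sum1dep_card big_mkcond /=.
elim/big_rec2: _ => //= p b n _ <-.
by case: ifP => _; rewrite ?oddD.
Qed.

Lemma odd_cinvDl (d : nat) (A B C : {set 'I_d}) :
  odd (cinv (symdiff A B) C) = odd (cinv A C) (+) odd (cinv B C).
Proof.
rewrite !odd_cinv -big_split /=; apply: eq_bigr => i _.
rewrite -big_split /=; apply: eq_bigr => j _; rewrite inE.
by case: (i \in A); case: (i \in B); case: (j \in C); case: leqP.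
Qed.

Lemma odd_cinvDr (d : nat) (A B C : {set 'I_d}) :
  odd (cinv A (symdiff B C)) = odd (cinv A B) (+) odd (cinv A C).
Proof.
rewrite !odd_cinv -big_split /=; apply: eq_bigr => i _.
rewrite -big_split /=; apply: eq_bigr => j _; rewrite inE.
by case: (i \in A); case: (j \in B); case: (j \in C); case: leqP.
Qed.

Lemma cliffordE (R : realType) (d : nat) (s : clifford R d) :
  s = \sum_A s A *: cbasis R A.
Proof.
apply/ffunP => B; rewrite sum_ffunE (bigD1 B) //= !ffunE eqxx.
rewrite big1 => [|A nAB]; first by rewrite addr0; exact/esym/mulr1.
by rewrite !ffunE eq_sym (negPf nAB); exact: mulr0.
Qed.

Lemma cmulDl (R : realType) (d : nat) : left_distributive (@cmul R d) +%R.
Proof.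
move=> s t u; rewrite /cmul -big_split /=; apply: eq_bigr => A _.
rewrite -big_split /=; apply: eq_bigr => B _.
by rewrite ffunE mulrDl mulrDr scalerDl.
Qed.

Lemma cmulDr (R : realType) (d : nat) : right_distributive (@cmul R d) +%R.
Proof.
move=> s t u; rewrite /cmul -big_split /=; apply: eq_bigr => A _.
rewrite -big_split /=; apply: eq_bigr => B _.
by rewrite ffunE !mulrDr scalerDl.
Qed.

Lemma cmulZl (R : realType) (d : nat) (a : R) (s t : clifford R d) :
  cmul (a *: s) t = a *: cmul s t.
Proof.
rewrite /cmul scaler_sumr; apply: eq_bigr => A _.
rewrite scaler_sumr; apply: eq_bigr => B _.
by rewrite ffunE scalerA -[a *: s A]/(a * s A) -mulrA mulrCA.
Qed.

Lemma cmulZr (R : realType) (d : nat) (a : R) (s t : clifford R d) :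
  cmul s (a *: t) = a *: cmul s t.
Proof.
rewrite /cmul scaler_sumr; apply: eq_bigr => A _.
rewrite scaler_sumr; apply: eq_bigr => B _.
by rewrite ffunE scalerA -[a *: t B]/(a * t B) [s A * _]mulrCA [_ ^+ _ * _]mulrCA.
Qed.

Lemma cmul0l (R : realType) (d : nat) (s : clifford R d) : cmul 0 s = 0.
Proof. by have := cmulZl 0 0 s; rewrite !scale0r. Qed.

Lemma cmul0r (R : realType) (d : nat) (s : clifford R d) : cmul s 0 = 0.
Proof. by have := cmulZr 0 s 0; rewrite !scale0r. Qed.

Lemma cmul_basis (R : realType) (d : nat) (A B : {set 'I_d}) :
  cmul (cbasis R A) (cbasis R B) = (-1) ^+ cinv A B *: cbasis R (symdiff A B).
Proof.
rewrite /cmul (bigD1 A) //= (bigD1 B) //= !ffunE !eqxx mulr1 mulr1.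
rewrite big1 => [|C nCB]; last first.
  by rewrite !ffunE (negPf nCB) !mulr0 scale0r.
rewrite addr0 big1 ?addr0 // => C nCA.
by apply: big1 => D _; rewrite !ffunE (negPf nCA) mul0r mulr0 scale0r.
Qed.

Lemma cinv_cocycle (R : realType) (d : nat) (A B C : {set 'I_d}) :
  (-1) ^+ cinv B C * (-1) ^+ cinv A (symdiff B C) =
  (-1) ^+ cinv A B * (-1) ^+ cinv (symdiff A B) C :> R.
Proof.
rewrite -(signr_odd R (cinv B C)) -(signr_odd R (cinv A (symdiff B C))).
rewrite -(signr_odd R (cinv A B)) -(signr_odd R (cinv (symdiff A B) C)).
rewrite odd_cinvDl odd_cinvDr -!signr_addb.
by congr (_ ^+ _); case: odd; case: odd; case: odd.
Qed.

Lemma clifford_ind (R : realType) (d : nat) (P : clifford R d -> Prop) :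
  P 0 -> (forall s t, P s -> P t -> P (s + t)) ->
  (forall a s, P s -> P (a *: s)) -> (forall A, P (cbasis R A)) ->
  forall s, P s.
Proof.
move=> P0 PD PZ Pe s; rewrite (cliffordE s).
by elim/big_ind: _ => // A _; exact: PZ.
Qed.

Lemma cmulA (R : realType) (d : nat) : associative (@cmul R d).
Proof.
move=> s t u.
elim/clifford_ind: s => [|s1 s2 IH1 IH2|a s IH|A].
- by rewrite !cmul0l.
- by rewrite !cmulDl IH1 IH2.
- by rewrite !cmulZl IH.
elim/clifford_ind: t => [|s1 s2 IH1 IH2|a s IH|B].
- by rewrite cmul0l !cmul0r cmul0l.
- by rewrite cmulDl !cmulDr cmulDl IH1 IH2.
- by rewrite cmulZl !cmulZr cmulZl IH.
elim/clifford_ind: u => [|s1 s2 IH1 IH2|a s IH|C].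
- by rewrite !cmul0r.
- by rewrite !cmulDr IH1 IH2.
- by rewrite !cmulZr IH.
rewrite !cmul_basis cmulZl cmulZr !cmul_basis symdiffA !scalerA.
by rewrite (cinv_cocycle R A B C).
Qed.

Lemma cmul1l (R : realType) (d : nat) :
  left_id (cbasis R finset.set0) (@cmul R d).
Proof.
elim/clifford_ind => [|s t IHs IHt|a s IHs|A].
- exact: cmul0r.
- by rewrite cmulDr IHs IHt.
- by rewrite cmulZr IHs.
rewrite cmul_basis symdiff0s -signr_odd odd_cinv.
rewrite big1 ?expr0 ?scale1r // => i _.
by rewrite big1 // => j _; rewrite inE.
Qed.

Lemma cmul1r (R : realType) (d : nat) :
  right_id (cbasis R finset.set0) (@cmul R d).
Proof.
elim/clifford_ind => [|s t IHs IHt|a s IHs|A].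
- exact: cmul0l.
- by rewrite cmulDl IHs IHt.
- by rewrite cmulZl IHs.
rewrite cmul_basis symdiffs0 -signr_odd odd_cinv.
rewrite big1 ?expr0 ?scale1r // => i _.
by rewrite big1 // => j _; rewrite inE andbF.
Qed.

Lemma cbasis0_neq0 (R : realType) (d : nat) :
  cbasis R (finset.set0 : {set 'I_d}) != 0.
Proof.
apply/eqP => /ffunP /(_ finset.set0); rewrite !ffunE eqxx => /eqP.
by rewrite oner_eq0.
Qed.

HB.instance Definition _ (R : realType) (d : nat) :=
  GRing.Zmodule_isNzRing.Build (clifford R d) (@cmulA R d) (@cmul1l R d)
    (@cmul1r R d) (@cmulDl R d) (@cmulDr R d) (cbasis0_neq0 R d).

Definition cgen (R : realType) (d : nat) (i : 'I_d) : clifford R d :=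
  cbasis R [set i]%SET.

Lemma cgen_sqr (R : realType) (d : nat) (i : 'I_d) :
  cgen R i * cgen R i = -1.
Proof.
rewrite /GRing.mul /= cmul_basis.
have -> : symdiff [set i]%SET [set i]%SET = finset.set0.
  by apply/setP => j; rewrite !inE addbb.
rewrite -[RHS]scaleN1r; congr (_ *: _).
suff -> : cinv [set i]%SET [set i]%SET = 1%N by rewrite expr1.
rewrite /cinv -(cards1 (i, i)); apply: eq_card => -[j k]; rewrite !inE /=.
rewrite xpair_eqE; case: eqP => //= ->; case: eqP => //= ->; exact: leqnn.
Qed.

Lemma cgen_anticomm (R : realType) (d : nat) (i j : 'I_d) : i != j ->
  cgen R i * cgen R j = - (cgen R j * cgen R i).
Proof.
move=> nij; rewrite /GRing.mul /= !cmul_basis.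
have -> : symdiff [set j]%SET [set i]%SET = symdiff [set i]%SET [set j]%SET.
  by apply/setP => k; rewrite !inE addbC.
rewrite -[RHS]scaleNr; congr (_ *: _).
have cE (k l : 'I_d) : cinv [set k]%SET [set l]%SET = (l <= k)%N.
  rewrite /cinv; case: leqP => lk.
    rewrite -[RHS](cards1 (k, l)); apply: eq_card => -[a b]; rewrite !inE /=.
    by rewrite xpair_eqE; case: eqP => //= ->; case: eqP => //= ->.
  apply/eqP; rewrite cards_eq0; apply/eqP/setP => -[a b]; rewrite !inE /=.
  by case: eqP => //= ->; case: eqP => //= ->; rewrite leqNgt lk.
rewrite !cE; case: (ltngtP i j) => ij; rewrite ?expr0 ?expr1 ?opprK //.
by move/val_inj: ij nij => ->; rewrite eqxx.
Qed.


Definition creal (R : realType) (d : nat) (x : R) : clifford R d :=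
  x *: (1 : clifford R d).

Definition cconj (R : realType) (d : nat) (s : clifford R d) : clifford R d :=
  [ffun A : {set 'I_d} => (-1) ^+ (#|A| * #|A|.+1)./2 * s A].

(* s.1 is the real part s_0 and s.2 the coordinate vector of Im s. *)
Notation paravector R d := (R * 'rV[R]_d)%type.

Definition pv (R : realType) (d : nat) (s : paravector R d) : clifford R d :=
  creal d s.1 + \sum_i s.2 0 i *: cgen R i.

Definition pconj (R : realType) (d : nat) (s : paravector R d) :
  paravector R d := (s.1, - s.2).

Definition pnormsq (R : realType) (d : nat) (s : paravector R d) : R :=
  s.1 ^+ 2 + \sum_i s.2 0 i ^+ 2.

Definition im_norm (R : realType) (d : nat) (s : paravector R d) : R :=
  Num.sqrt (\sum_i s.2 0 i ^+ 2).

Definition sphere (R : realType) (d : nat) : set 'rV[R]_d :=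
  [set J | \sum_i J 0 i ^+ 2 = 1].

(* The point x + J y of C_J. *)
Definition slice (R : realType) (d : nat) (J : 'rV[R]_d) (z : R * R) :
  paravector R d := (z.1, z.2 *: J).

Definition axially_symmetric (R : realType) (d : nat)
    (U : set (paravector R d)) : Prop :=
  forall s J, U s -> sphere J -> U (slice J (s.1, im_norm s)).

(* Below, a function on U is represented by a total function of which only   *)
(* the values on U are constrained.                                          *)

Definition plane_domain (R : realType) (d : nat) (U : set (paravector R d)) :
  set (R * R) := [set z | forall J, sphere J -> U (slice J z)].

Definition dx (R : realType) (d : nat) (g : R * R -> clifford R d)
    (A : {set 'I_d}) (z : R * R) : R :=
  'D_((1, 0) : R * R) (fun w => g w A) z.

Definition dy (R : realType) (d : nat) (g : R * R -> clifford R d)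
    (A : {set 'I_d}) (z : R * R) : R :=
  'D_((0, 1) : R * R) (fun w => g w A) z.

(* g is C^1 on the open set D: every coordinate has continuous first order   *)
(* partial derivatives there.                                                *)
Definition C1_on (R : realType) (d : nat) (D : set (R * R))
    (g : R * R -> clifford R d) : Prop :=
  forall z A, D z ->
    [/\ derivable (fun w => g w A) z ((1, 0) : R * R),
        derivable (fun w => g w A) z ((0, 1) : R * R),
        {for z, continuous (dx g A)} & {for z, continuous (dy g A)}].

Definition slice_pair (R : realType) (d : nat) (U : set (paravector R d))
    (f0 f1 : R * R -> clifford R d) : Prop :=
  [/\ C1_on (plane_domain U) f0, C1_on (plane_domain U) f1,
      forall z, plane_domain U z ->
        f0 (z.1, - z.2) = f0 z /\ f1 (z.1, - z.2) = - f1 z &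
      forall z A, plane_domain U z ->
        dx f0 A z = dy f1 A z /\ dy f0 A z = - dx f1 A z].

Definition SH_L (R : realType) (d : nat) (U : set (paravector R d))
    (f : paravector R d -> clifford R d) : Prop :=
  exists f0 f1, slice_pair U f0 f1 /\
    forall z J, plane_domain U z -> sphere J ->
      f (slice J z) = f0 z + pv (0, J) * f1 z.

Definition SH_R (R : realType) (d : nat) (U : set (paravector R d))
    (f : paravector R d -> clifford R d) : Prop :=
  exists f0 f1, slice_pair U f0 f1 /\
    forall z J, plane_domain U z -> sphere J ->
      f (slice J z) = f0 z + f1 z * pv (0, J).

Definition intrinsic (R : realType) (d : nat) (U : set (paravector R d))
    (f : paravector R d -> clifford R d) : Prop :=
  exists f0 f1 : R * R -> R,
    slice_pair U (fun z => creal d (f0 z)) (fun z => creal d (f1 z)) /\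
    forall z J, plane_domain U z -> sphere J ->
      f (slice J z) = creal d (f0 z) + pv (0, J) * creal d (f1 z).

Definition fsharp (R : realType) (d : nat)
    (f : paravector R d -> clifford R d) : paravector R d -> clifford R d :=
  fun s => cconj (f (pconj s)).

(* A real Hilbert space is a complete normed space whose norm comes from an  *)
(* inner product.                                                            *)
Definition inner_product (R : realType) (VR : completeNormedModType R)
    (ip : VR -> VR -> R) : Prop :=
  [/\ forall a x y z, ip (a *: x + y) z = a * ip x z + ip y z,
      forall x y, ip x y = ip y x &
      forall x, ip x x = `|x| ^+ 2].

(* v A is the component v_A of v = \sum_A v_A (x) e_A. *)
Notation hmodule VR d := {ffun {set 'I_d} -> VR}.

Definition lact (R : realType) (d : nat) (VR : completeNormedModType R)
    (s : clifford R d) (v : hmodule VR d) : hmodule VR d :=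
  [ffun C => \sum_A \sum_B ((cbasis R B * cbasis R A) C * s B) *: v A].

Definition ract (R : realType) (d : nat) (VR : completeNormedModType R)
    (v : hmodule VR d) (s : clifford R d) : hmodule VR d :=
  [ffun C => \sum_A \sum_B ((cbasis R A * cbasis R B) C * s B) *: v A].

Definition hinner (R : realType) (d : nat) (VR : completeNormedModType R)
    (ip : VR -> VR -> R) (v w : hmodule VR d) : clifford R d :=
  \sum_A \sum_B ip (v A) (w B) *: (cconj (cbasis R A) * cbasis R B).

Definition hnorm (R : realType) (d : nat) (VR : completeNormedModType R)
    (v : hmodule VR d) : R := Num.sqrt (\sum_A `|v A| ^+ 2).

(* The operator norm of T is at most M. *)
Definition opnorm_le (R : realType) (d : nat) (VR : completeNormedModType R)
    (T : hmodule VR d -> hmodule VR d) (M : R) : Prop :=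
  forall v, hnorm (T v) <= M * hnorm v.

(* T belongs to B(V). *)
Definition bounded_op (R : realType) (d : nat) (VR : completeNormedModType R)
    (T : hmodule VR d -> hmodule VR d) : Prop :=
  [/\ forall u v, T (u + v) = T u + T v,
      forall v s, T (ract v s) = ract (T v) s &
      exists M, opnorm_le T M].

Definition adjoint (R : realType) (d : nat) (VR : completeNormedModType R)
    (ip : VR -> VR -> R) (T : hmodule VR d -> hmodule VR d) :
    hmodule VR d -> hmodule VR d :=
  xget (fun=> 0) [set S | bounded_op S /\
    forall v w, hinner ip (S w) v = hinner ip w (T v)].

Definition Qop (R : realType) (d : nat) (VR : completeNormedModType R)
    (T : hmodule VR d -> hmodule VR d) (s : paravector R d) :
    hmodule VR d -> hmodule VR d :=
  fun v => T (T v) - (2 * s.1) *: T v + pnormsq s *: v.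

Definition inverse_op (R : realType) (d : nat) (VR : completeNormedModType R)
    (T P : hmodule VR d -> hmodule VR d) : Prop :=
  [/\ bounded_op P, cancel T P & cancel P T].

Definition S_resolvent_set (R : realType) (d : nat)
    (VR : completeNormedModType R) (T : hmodule VR d -> hmodule VR d) :
    set (paravector R d) := [set s | exists P, inverse_op (Qop T s) P].

Definition S_spectrum (R : realType) (d : nat)
    (VR : completeNormedModType R) (T : hmodule VR d -> hmodule VR d) :
    set (paravector R d) := ~` S_resolvent_set T.

Definition Qinv (R : realType) (d : nat) (VR : completeNormedModType R)
    (T : hmodule VR d -> hmodule VR d) (s : paravector R d) :
    hmodule VR d -> hmodule VR d :=
  xget (fun=> 0) [set P | inverse_op (Qop T s) P].

Definition SL_resolvent (R : realType) (d : nat)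
    (VR : completeNormedModType R) (T : hmodule VR d -> hmodule VR d)
    (s : paravector R d) : hmodule VR d -> hmodule VR d :=
  fun v => Qinv T s (lact (cconj (pv s)) v) - T (Qinv T s v).

Definition SR_resolvent (R : realType) (d : nat)
    (VR : completeNormedModType R) (T : hmodule VR d -> hmodule VR d)
    (s : paravector R d) : hmodule VR d -> hmodule VR d :=
  fun v => lact (cconj (pv s)) (Qinv T s v) - T (Qinv T s v).

(* The integral over [0, 1] of an operator valued function is the limit of   *)
(* tagged Riemann sums in operator norm.                                     *)

Definition tagged_partition (R : realType) (n : nat) (t xi : nat -> R)
    (mesh : R) : Prop :=
  [/\ t 0%N = 0, t n = 1 &
      forall i, (i < n)%N ->
        [/\ t i <= xi i, xi i <= t i.+1 & t i.+1 - t i < mesh]].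

Definition is_op_integral (R : realType) (d : nat)
    (VR : completeNormedModType R)
    (F : R -> hmodule VR d -> hmodule VR d)
    (I : hmodule VR d -> hmodule VR d) : Prop :=
  bounded_op I /\
  forall eps, 0 < eps -> exists2 mesh, 0 < mesh &
    forall n t xi, tagged_partition n t xi mesh ->
      opnorm_le
        (fun v => \sum_(i < n) (t i.+1 - t i) *: F (xi i) v - I v) eps.

Definition op_integral (R : realType) (d : nat)
    (VR : completeNormedModType R)
    (F : R -> hmodule VR d -> hmodule VR d) : hmodule VR d -> hmodule VR d :=
  xget (fun=> 0) [set I | is_op_integral F I].

(* A closed path in C_J is given by a map gam : [0, 1] -> R^2 in plane       *)
(* coordinates, as t |-> slice J (gam t).                                    *)

(* The derivative on the open interval extends continuously to [a, b].       *)
Definition C1_arc (R : realType) (gam : R -> R * R) (a b : R) : Prop :=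
  exists g : R -> R * R, {within `[a, b], continuous g} /\
    forall t, a < t < b -> is_derive t 1 gam (g t).

Definition piecewise_C1 (R : realType) (gam : R -> R * R) : Prop :=
  {within `[0, 1], continuous gam} /\
  exists (n : nat) (t : nat -> R),
    [/\ t 0%N = 0, t n = 1 &
        forall i, (i < n)%N -> t i < t i.+1 /\ C1_arc gam (t i) (t i.+1)].

Definition jordan_curve (R : realType) (gam : R -> R * R) : Prop :=
  [/\ piecewise_C1 gam, gam 0 = gam 1 &
      forall s t, 0 <= s < 1 -> 0 <= t < 1 -> gam s = gam t -> s = t].

(* Winding number of the closed path gam around z, through a continuous      *)
(* choice theta of the argument of gam - z; it is well defined when gam is   *)
(* continuous and avoids z.                                                  *)
Definition winding (R : realType) (gam : R -> R * R) (z : R * R) : R :=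
  xget 0 [set w | exists r theta : R -> R,
    [/\ {within `[0, 1], continuous theta},
        forall t, 0 <= t <= 1 -> 0 < r t /\
          gam t = (z.1 + r t * cos (theta t), z.2 + r t * sin (theta t)) &
        w = (theta 1 - theta 0) / (2 * pi)]].

(* The curves in Gam cover the boundary of U in C_J and are jointly          *)
(* positively oriented: they wind once around the points of U and do not     *)
(* wind around the points outside the closure of U.                          *)
Definition oriented_boundary (R : realType) (d : nat)
    (U : set (paravector R d)) (J : 'rV[R]_d) (Gam : seq (R -> R * R)) :
    Prop :=
  [/\ forall i, (i < size Gam)%N -> jordan_curve (nth (fun=> 0) Gam i),
      forall z, (closure U `\` U°) (slice J z) <->
        exists i t, [/\ (i < size Gam)%N, 0 <= t <= 1 &
                        nth (fun=> 0) Gam i t = z],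
      forall z, U (slice J z) -> \sum_(gam <- Gam) winding gam z = 1 &
      forall z, ~ closure U (slice J z) ->
        \sum_(gam <- Gam) winding gam z = 0].

Definition admissible (R : realType) (d : nat) (K U' U : set (paravector R d))
    (J : 'rV[R]_d) (Gam : seq (R -> R * R)) : Prop :=
  [/\ [/\ open U, bounded_set U & axially_symmetric U],
      K `<=` U, closure U `<=` U', sphere J & oriented_boundary U J Gam].

(* At the finitely many t where gam is not differentiable, derive1 gam t is  *)
(* a default value, which does not affect the Riemann integrals.             *)
Definition dsJ (R : realType) (d : nat) (J : 'rV[R]_d) (gam : R -> R * R)
    (t : R) : clifford R d :=
  - pv (0, J) * pv (slice J (derive1 gam t)).

Definition left_integral (R : realType) (d : nat)
    (VR : completeNormedModType R) (T : hmodule VR d -> hmodule VR d)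
    (f : paravector R d -> clifford R d) (J : 'rV[R]_d)
    (Gam : seq (R -> R * R)) : hmodule VR d -> hmodule VR d :=
  fun v => (2 * pi)^-1 *: \sum_(gam <- Gam) op_integral (fun t w =>
    SL_resolvent T (slice J (gam t))
      (lact (dsJ J gam t) (lact (f (slice J (gam t))) w))) v.

Definition right_integral (R : realType) (d : nat)
    (VR : completeNormedModType R) (T : hmodule VR d -> hmodule VR d)
    (f : paravector R d -> clifford R d) (J : 'rV[R]_d)
    (Gam : seq (R -> R * R)) : hmodule VR d -> hmodule VR d :=
  fun v => (2 * pi)^-1 *: \sum_(gam <- Gam) op_integral (fun t w =>
    lact (f (slice J (gam t))) (lact (dsJ J gam t)
      (SR_resolvent T (slice J (gam t)) w))) v.

Definition left_values (R : realType) (d : nat)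
    (VR : completeNormedModType R) (U' : set (paravector R d))
    (T : hmodule VR d -> hmodule VR d) (f : paravector R d -> clifford R d) :
    set (hmodule VR d -> hmodule VR d) :=
  [set A | exists U J Gam, admissible (S_spectrum T) U' U J Gam /\
                           A = left_integral T f J Gam].

Definition right_values (R : realType) (d : nat)
    (VR : completeNormedModType R) (U' : set (paravector R d))
    (T : hmodule VR d -> hmodule VR d) (f : paravector R d -> clifford R d) :
    set (hmodule VR d -> hmodule VR d) :=
  [set A | exists U J Gam, admissible (S_spectrum T) U' U J Gam /\
                           A = right_integral T f J Gam].

Definition the_op (R : realType) (d : nat) (VR : completeNormedModType R)
    (E : set (hmodule VR d -> hmodule VR d)) : hmodule VR d -> hmodule VR d :=
  xget (fun=> 0) [set A | E = [set A]].

(* f(T) is the value of the integral, which is the same for all admissible   *)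
(* choices of U, J and parametrized boundary.                                *)
Definition left_calculus (R : realType) (d : nat)
    (VR : completeNormedModType R) (U' : set (paravector R d))
    (T : hmodule VR d -> hmodule VR d) (f : paravector R d -> clifford R d) :
    hmodule VR d -> hmodule VR d := the_op (left_values U' T f).

Definition right_calculus (R : realType) (d : nat)
    (VR : completeNormedModType R) (U' : set (paravector R d))
    (T : hmodule VR d -> hmodule VR d) (f : paravector R d -> clifford R d) :
    hmodule VR d -> hmodule VR d := the_op (right_values U' T f).

(* For intrinsic f the left and the right integrals have the same value.     *)
Definition intrinsic_calculus (R : realType) (d : nat)
    (VR : completeNormedModType R) (U' : set (paravector R d))
    (T : hmodule VR d -> hmodule VR d) (f : paravector R d -> clifford R d) :
    hmodule VR d -> hmodule VR d :=
  the_op (left_values U' T f `|` right_values U' T f).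

(* Main.v *)
Require Import Defs.
From mathcomp Require Import all_boot all_order all_algebra.
From mathcomp Require Import all_classical all_reals all_analysis.
From mathcomp Require Import lra ring.
Set Implicit Arguments. Unset Strict Implicit. Unset Printing Implicit Defensive.
Import Order.TTheory GRing.Theory Num.Theory.
Import numFieldNormedType.Exports.
Local Open Scope classical_set_scope.
Local Open Scope ring_scope.

(** Let [S] be the adjoint of [T].  The operators [Qop S s] and [Qop T s] are
    adjoint to each other, hence so are their inverses; moreover
    [Qop T s = Qop T (pconj s)], and the inverse commutes with [T].  Taking
    adjoints in [Q^-1 (cconj s) - S Q^-1] therefore gives
    [s Q^-1 - T Q^-1]: the left resolvent of [S] at [s] is the adjoint of the
    right resolvent of [T] at [pconj s] ([adjoint_pair_resolvent]).  The
    adjoint of left multiplication by a Clifford number is left multiplication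
    by its conjugate, so the integrand of [f(S)] at [s] is the adjoint of the
    integrand of [fsharp f (T)] at [pconj s], provided that the line element
    is conjugated as well.

    Conjugating a curve in the plane reverses its orientation.  This is
    avoided by replacing [J] by [- J] and keeping the plane curve:
    [x + (-J) y] is the conjugate of [x + J y], the line element for [- J] is
    the conjugate of the one for [J] ([dsJ_opp]), and an axially symmetric set
    is invariant under conjugation, so [(U, J, Gam)] and [(U, -J, Gam)] are
    admissible simultaneously ([admissible_opp]).

    Adjunction is preserved by Riemann sums and, since adjoint operators have
    the same norm bounds, by their limits: one of two pointwise adjoint
    integrands is integrable exactly when the other one is, and the integrals
    are adjoint ([adjoint_pair_op_integral]).  Consequently [adjoint ip],
    which is an involution of the bounded operators, maps the set of all values
    of the integrals for [fsharp f (T)] onto the set of all values for [f(S)]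
    ([left_values_adjoint], [right_values_adjoint]).  One of the two sets is a
    singleton exactly when the other one is, and then their elements are
    adjoint to each other.  If [f] is intrinsic, [fsharp f] and [f] agree on
    the curves of integration.

    Adjoints exist by the Riesz representation theorem in the real Hilbert
    space of components; right linearity upgrades the adjunction for the real
    part of the inner product to the Clifford-valued one
    ([adjoint_pair_exists]). *)

(** * Clifford conjugation *)

Section CliffordConjugation.
Variables (R : realType) (d : nat).
Implicit Types (s t : clifford R d) (A B C : {set 'I_d}).

Lemma cscaleAl (a : R) s t : (a *: s) * t = a *: (s * t).
Proof. exact: cmulZl. Qed.

Lemma cscaleAr (a : R) s t : s * (a *: t) = a *: (s * t).
Proof. exact: cmulZr. Qed.

Lemma cbasisM A B :
  cbasis R A * cbasis R B = (-1) ^+ cinv A B *: cbasis R (symdiff A B).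
Proof. exact: cmul_basis. Qed.

(** The pairs of [A x A] below and above the diagonal are equinumerous and
    meet in the diagonal, so twice their number is [#|A|^2 + #|A|].  Thus the
    sign in [cconj] is the sign of the square of a basis element, and inherits
    the bilinearity modulo 2 of [cinv]. *)
Lemma cinv_diag A : cinv A A = ((#|A| * #|A|.+1)./2)%N.
Proof.
pose L := [set p : 'I_d * 'I_d | [&& p.1 \in A, p.2 \in A & (p.2 <= p.1)%N]]%SET.
pose U := [set p : 'I_d * 'I_d | [&& p.1 \in A, p.2 \in A & (p.1 <= p.2)%N]]%SET.
have cLU : #|L| = #|U|.
  pose swap (p : 'I_d * 'I_d) := (p.2, p.1).
  have swapK : involutive swap by case.
  rewrite -(card_imset _ (inv_inj swapK)); apply: eq_card => p.
  apply/imsetP/idP => [[q + ->]|pU]; first by rewrite !inE /= andbCA.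
  by exists (swap p); rewrite ?swapK // !inE /= andbCA; move: pU; rewrite !inE.
have LUU : (L :|: U = finset.setX A A)%SET.
  apply/setP => p; rewrite !inE; case: (p.1 \in A) => //=.
  by case: (p.2 \in A) => //=; exact: leq_total.
have LUI : #|(L :&: U)%SET| = #|A|.
  rewrite -(card_imset (mem A) (f := fun i => (i, i))); last by move=> i j [].
  apply: eq_card => -[i j]; rewrite !inE /=; apply/idP/imsetP => [|[k kA [-> ->]]].
    case/andP => /and3P[iA jA ji] /and3P[_ _ ij]; exists i => //; congr pair.
    by apply/val_inj/eqP; rewrite eqn_leq ji ij.
  by rewrite kA leqnn.
have := cardsUI L U; rewrite LUU LUI cardsX -cLU addnn addnC -mulnS => ->.
by rewrite doubleK.
Qed.

Lemma cconjE s A : cconj s A = (-1) ^+ cinv A A * s A.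
Proof. by rewrite ffunE cinv_diag. Qed.

Lemma cconjD s t : cconj (s + t) = cconj s + cconj t.
Proof. by apply/ffunP => A; rewrite !ffunE mulrDr. Qed.

Lemma cconjZ (a : R) s : cconj (a *: s) = a *: cconj s.
Proof. by apply/ffunP => A; rewrite !ffunE; exact: mulrCA. Qed.

Lemma cconj0 : cconj (0 : clifford R d) = 0.
Proof. by apply/ffunP => A; rewrite !ffunE mulr0. Qed.

Lemma cconjN s : cconj (- s) = - cconj s.
Proof. by rewrite -scaleN1r cconjZ scaleN1r. Qed.

Lemma cconj_sum (I : Type) (r : seq I) (P : pred I) (F : I -> clifford R d) :
  cconj (\sum_(i <- r | P i) F i) = \sum_(i <- r | P i) cconj (F i).
Proof. exact: (big_morph _ cconjD cconj0). Qed.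

Lemma cconjK : involutive (@cconj R d).
Proof.
move=> s; apply/ffunP => A.
by rewrite !cconjE mulrA -exprD addnn -signr_odd odd_double expr0 mul1r.
Qed.

Lemma cconj_cbasis A :
  cconj (cbasis R A) = (-1) ^+ cinv A A *: cbasis R A.
Proof.
apply/ffunP => B; rewrite cconjE !ffunE.
by case: (eqVneq B A) => [-> //|_]; rewrite mulr0; exact/esym/mulr0.
Qed.

Lemma symdiffC A B : symdiff A B = symdiff B A.
Proof. by apply/setP => i; rewrite !inE addbC. Qed.

(** On basis elements both sides are signs times the same basis element, and
    by bilinearity of [cinv] modulo 2 the diagonal value at [symdiff A B]
    exceeds the sum of those at [A] and [B] by [cinv A B + cinv B A]. *)
Lemma cconjM s t : cconj (s * t) = cconj t * cconj s.
Proof.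
elim/clifford_ind: s => [|s1 s2 IH1 IH2|a s IH|A].
- by rewrite mul0r cconj0 mulr0.
- by rewrite mulrDl !cconjD mulrDr IH1 IH2.
- by rewrite cscaleAl !cconjZ cscaleAr IH.
elim/clifford_ind: t => [|s1 s2 IH1 IH2|a s IH|B].
- by rewrite mulr0 cconj0 mul0r.
- by rewrite mulrDr !cconjD mulrDl IH1 IH2.
- by rewrite cscaleAr !cconjZ cscaleAl IH.
rewrite !cconj_cbasis cscaleAl cscaleAr !cbasisM cconjZ cconj_cbasis.
rewrite symdiffC !scalerA; congr (_ *: _).
rewrite -(signr_odd R (cinv A B)) -(signr_odd R (cinv (symdiff _ _) _)).
rewrite -(signr_odd R (cinv B B)) -(signr_odd R (cinv A A)).
rewrite -(signr_odd R (cinv B A)).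
rewrite odd_cinvDl !odd_cinvDr -!signr_addb.
by congr (_ ^+ _); do 4 case: odd.
Qed.

Lemma cconj1 : cconj (1 : clifford R d) = 1.
Proof. by rewrite -[LHS]mulr1 -{2}[1]cconjK -cconjM mulr1 cconjK. Qed.

Lemma cconj_creal (a : R) : cconj (creal d a) = creal d a.
Proof. by rewrite cconjZ cconj1. Qed.

Lemma crealM (a : R) s : creal d a * s = a *: s.
Proof. by rewrite cscaleAl mul1r. Qed.

Lemma crealMr (a : R) s : s * creal d a = a *: s.
Proof. by rewrite cscaleAr mulr1. Qed.

Lemma symdiff_eq0 A B : (symdiff A B == finset.set0) = (A == B).
Proof.
apply/eqP/eqP => [/setP AB|->]; apply/setP => i; last by rewrite !inE addbb.
by move: (AB i); rewrite !inE; do 2 case: (_ \in _).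
Qed.

Lemma cbasis_orthonormal A B :
  (cconj (cbasis R A) * cbasis R B) finset.set0 = (A == B)%:R.
Proof.
rewrite cconj_cbasis cscaleAl cbasisM scalerA !ffunE eq_sym symdiff_eq0.
case: (eqVneq A B) => [->|_]; last exact: mulr0.
by rewrite -exprD addnn -signr_odd odd_double expr0; exact: mul1r.
Qed.

(** Since [cconj e_A] is the inverse of [e_A], every coordinate is the real
    part of a product; the real part is thus a nondegenerate functional. *)
Lemma mul_cbasis_real s A : (s * cconj (cbasis R A)) finset.set0 = s A.
Proof.
elim/clifford_ind: s => [|s t IHs IHt|a s IH|B].
- by rewrite mul0r !ffunE.
- by rewrite mulrDl !ffunE IHs IHt.
- by rewrite cscaleAl ffunE IH [RHS]ffunE.
rewrite cconj_cbasis cscaleAr cbasisM scalerA !ffunE eq_sym symdiff_eq0 eq_sym.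
case: (eqVneq A B) => [->|_]; last exact: mulr0.
by rewrite -exprD addnn -signr_odd odd_double expr0; exact: mul1r.
Qed.

Lemma mul_real_inj s t :
  (forall u, (s * u) finset.set0 = (t * u) finset.set0) -> s = t.
Proof. by move=> st; apply/ffunP => A; rewrite -(mul_cbasis_real s) -(mul_cbasis_real t). Qed.

End CliffordConjugation.

(** * Riesz representation in a real Hilbert space *)

Section RealInnerProduct.
Variables (R : realType) (VR : completeNormedModType R) (ip : VR -> VR -> R).
Hypothesis ip_inner : inner_product ip.
Implicit Types x y z : VR.

Lemma ipC x y : ip x y = ip y x.
Proof. by case: ip_inner. Qed.

Lemma ipxx x : ip x x = `|x| ^+ 2.
Proof. by case: ip_inner. Qed.

Lemma ipDl x y z : ip (x + y) z = ip x z + ip y z.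
Proof. by case: ip_inner => L _ _; rewrite -{1}[x]scale1r L mul1r. Qed.

Lemma ip0l z : ip 0 z = 0.
Proof. by apply: (addrI (ip 0 z)); rewrite -ipDl !addr0. Qed.

Lemma ipZl a x z : ip (a *: x) z = a * ip x z.
Proof. by case: ip_inner => L _ _; rewrite -[a *: x]addr0 L ip0l addr0. Qed.

Lemma ipNl x z : ip (- x) z = - ip x z.
Proof. by rewrite -scaleN1r ipZl mulN1r. Qed.

Lemma ipDr x y z : ip z (x + y) = ip z x + ip z y.
Proof. by rewrite ipC ipDl !(ipC z). Qed.

Lemma ipZr a x z : ip z (a *: x) = a * ip z x.
Proof. by rewrite ipC ipZl (ipC z). Qed.

Lemma ipNr x z : ip z (- x) = - ip z x.
Proof. by rewrite ipC ipNl (ipC z). Qed.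

Lemma ip_suml (I : Type) (r : seq I) (P : pred I) (F : I -> VR) z :
  ip (\sum_(i <- r | P i) F i) z = \sum_(i <- r | P i) ip (F i) z.
Proof. by apply: (big_morph (fun x => ip x z)) => [x y|]; rewrite ?ipDl ?ip0l. Qed.

Lemma ip_sumr (I : Type) (r : seq I) (P : pred I) (F : I -> VR) z :
  ip z (\sum_(i <- r | P i) F i) = \sum_(i <- r | P i) ip z (F i).
Proof. by rewrite ipC ip_suml; apply: eq_bigr => i _; rewrite ipC. Qed.

Lemma normsqD x y : `|x + y| ^+ 2 = `|x| ^+ 2 + 2 * ip x y + `|y| ^+ 2.
Proof. by rewrite -!ipxx ipDl !ipDr (ipC y x); lra. Qed.

(** Cauchy-Schwarz, reduced to unit vectors [u], [v], for which it is
    [0 <= |u - v|^2]. *)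
Lemma ip_le_norm x y : `|ip x y| <= `|x| * `|y|.
Proof.
have H (u v : VR) : `|u| = 1 -> `|v| = 1 -> ip u v <= 1.
  move=> u1 v1; have := sqr_ge0 `|u - v|.
  by rewrite normsqD ipNr normrN u1 v1; lra.
have [->|x0] := eqVneq x 0; first by rewrite ip0l !normr0 mul0r.
have [->|y0] := eqVneq y 0; first by rewrite ipC ip0l !normr0 mulr0.
have nx : 0 < `|x| by rewrite normr_gt0.
have ny : 0 < `|y| by rewrite normr_gt0.
have n1 z : z != 0 -> `| `|z|^-1 *: z | = 1.
  move=> z0; rewrite normrZ ger0_norm ?invr_ge0 ?normr_ge0 // mulVf //.
  by rewrite normr_eq0.
have key s : `|s| = 1 -> s * ip x y <= `|x| * `|y|.
  move=> s1; have := H (`|x|^-1 *: x) (s *: (`|y|^-1 *: y)) (n1 _ x0).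
  rewrite normrZ s1 mul1r n1 // => /(_ erefl).
  rewrite ipZr ipZl ipZr => h.
  rewrite -[leRHS]mul1r -ler_pdivrMr ?mulr_gt0 //.
  by apply: le_trans h; rewrite invfM; lra.
rewrite ler_norml; apply/andP; split.
  by have := key (-1); rewrite normrN1 mulN1r => /(_ erefl); lra.
by have := key 1; rewrite normr1 mul1r => /(_ erefl).
Qed.

(** Riesz representation *)
(** The representing vector is the minimizer of [J x = |x|^2 - 2 phi x].
    By the parallelogram law minimizing sequences are Cauchy, and the first
    variation of [J] at the limit [y] is [2 (ip y z - phi z)]. *)
Lemma riesz_representation (phi : VR -> R) (M : R) :
  (forall x y, phi (x + y) = phi x + phi y) ->
  (forall a x, phi (a *: x) = a * phi x) ->
  (forall x, phi x <= M * `|x|) ->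
  exists y, forall x, ip y x = phi x.
Proof.
move=> phiD phiZ phiM.
pose J x := `|x| ^+ 2 - 2 * phi x.
have J_ge x : - M ^+ 2 <= J x.
  have := phiM x; have := sqr_ge0 (`|x| - M); rewrite /J; nra.
pose m := inf (range J).
have hJ : has_inf (range J).
  split; first by exists (J 0), 0.
  by exists (- M ^+ 2) => _ [x _ <-].
have m_le x : m <= J x by apply: ge_inf; [case: hJ|exists x].
have /choice [u uJ] : forall n : nat, exists x, J x <= m + n.+1%:R^-1.
  move=> n; have n0 : 0 < n.+1%:R^-1 :> R by rewrite invr_gt0.
  by have [_ [x _ <-] /ltW] := inf_adherent n0 hJ; exists x.
(* parallelogram law; [m] is compared with [J] at the midpoint *)
have para x y : `|x - y| ^+ 2 <= 2 * (J x - m) + 2 * (J y - m).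
  have := m_le (2^-1 *: (x + y)); rewrite /J phiZ phiD normrZ.
  rewrite exprMn (ger0_norm (x := 2^-1)) ?invr_ge0 // !normsqD ipNr normrN.
  by lra.
(* [x] minimizes [J] up to [J x - m] along every line *)
have var x z t : - (J x - m) <= 2 * t * (ip x z - phi z) + t ^+ 2 * `|z| ^+ 2.
  have := m_le (x + t *: z); rewrite /J phiD phiZ normsqD ipZr normrZ exprMn.
  by rewrite -normrX ger0_norm ?sqr_ge0 //; lra.
have invn_le (e : R) : 0 < e -> exists N : nat, forall n, (N <= n)%N -> n.+1%:R^-1 <= e.
  move=> e0; exists (Num.truncn e^-1) => n Nn.
  rewrite -[e]invrK lef_pV2 ?posrE ?invr_gt0 //.
  apply: le_trans (ltW (truncnS_gt _)) _.
  by rewrite ler_nat.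
have /cauchy_cvgP /cvg_ex [y uy] : cauchy (u @ \oo).
  apply: cauchy_exP => e e0.
  have e2 : 0 < e ^+ 2 / 8 by rewrite divr_gt0 // exprn_gt0.
  have [N hN] := invn_le _ e2.
  exists (u N); exists N => // n /= Nn; rewrite -ball_normE /=.
  rewrite -(ltr_pXn2r (n := 2)) ?nnegrE ?normr_ge0 ?ltW //.
  apply: le_lt_trans (para _ _) _.
  have uN k : (N <= k)%N -> J (u k) - m <= e ^+ 2 / 8.
    by move=> Nk; rewrite lerBlDl (le_trans (uJ k)) // lerD2l hN.
  have := uN _ Nn; have := uN _ (leqnn N).
  by lra.
exists y => z; apply/eqP; rewrite -subr_eq0; apply/negPn/negP => b0.
set b := ip y z - phi z in b0.
have b2 : 0 < b ^+ 2 by rewrite exprn_even_gt0.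
pose K := `|z| ^+ 2 + 1.
have K0 : 0 < K by rewrite ltr_wpDl // sqr_ge0.
have bK : 0 < b ^+ 2 / (8 * K) by apply: divr_gt0 => //; exact: mulr_gt0.
have [N1 hN1] := invn_le _ bK.
have z1 : 0 < `|z| + 1 by have := normr_ge0 z; lra.
have e0 : 0 < `|b| / (2 * (`|z| + 1)).
  by rewrite divr_gt0 ?normr_gt0 // mulr_gt0.
have [N2 _ hN2] := (proj1 (cvgrPdist_lt _ _) uy) _ e0.
pose n := maxn N1 N2.
have un : J (u n) - m <= b ^+ 2 / (8 * K).
  by rewrite lerBlDl (le_trans (uJ n)) // lerD2l hN1 // leq_maxl.
have yun := hN2 n (leq_maxr _ _).
pose c := ip (u n) z - phi z.
have bc : `|b - c| <= `|b| / 2.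
  have -> : b - c = ip (y - u n) z by rewrite ipDl ipNl /b /c; lra.
  apply: le_trans (ip_le_norm _ _) _.
  have -> : `|b| / 2 = `|b| / (2 * (`|z| + 1)) * (`|z| + 1).
    by rewrite invfM mulrA divfK // gt_eqF.
  by apply: ler_pM => //; [exact: ltW|rewrite lerDl].
have c_ge : `|b| / 2 <= `|c|.
  by have := ler_normD (b - c) c; rewrite subrK; lra.
have c2 : b ^+ 2 / 4 <= c ^+ 2.
  rewrite -(real_normK (num_real b)) -(real_normK (num_real c)).
  by have := normr_ge0 b; nra.
have cK : c ^+ 2 / K <= J (u n) - m.
  (* nearly optimal step: [- c / |z|^2], with [K] in place of [|z|^2] as [z] may be [0] *)
  have := var (u n) z (- c / K); rewrite -/c.
  have -> : 2 * (- c / K) * c + (- c / K) ^+ 2 * `|z| ^+ 2 =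
            - (c ^+ 2 / K) - (c / K) ^+ 2.
    have : K * K^-1 = 1 by rewrite divff // gt_eqF.
    move: (K^-1) => k; rewrite /K; move: (`|z| ^+ 2) => X Xk.
    rewrite -[c ^+ 2 * k]mulr1 -Xk; ring: Xk.
  by have := sqr_ge0 (c / K); lra.
have : b ^+ 2 / 4 / K <= b ^+ 2 / (8 * K).
  by apply: le_trans un; apply: le_trans cK; rewrite ler_pM2r ?invr_gt0.
rewrite invfM; have : 0 < b ^+ 2 / K by rewrite divr_gt0.
by lra.
Qed.

End RealInnerProduct.

(** * The Clifford-valued inner product *)

Section HilbertModule.
Variables (R : realType) (d : nat) (VR : completeNormedModType R).
Variable ip : VR -> VR -> R.
Hypothesis ip_inner : inner_product ip.
Local Notation V := (hmodule VR d).
Local Notation "<< v , w >>" := (hinner ip v w).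
Implicit Types (u v w : V) (s : clifford R d) (A B C : {set 'I_d}).

Definition rinner v w : R := \sum_A ip (v A) (w A).

(** The real part of the inner product turns the module into a real Hilbert
    space, the orthogonal sum of copies of [VR]. *)
Lemma hinner_real v w : << v, w >> finset.set0 = rinner v w.
Proof.
rewrite /hinner sum_ffunE; apply: eq_bigr => A _; rewrite sum_ffunE (bigD1 A) //=.
rewrite ffunE cbasis_orthonormal eqxx big1 ?addr0 => [|B nBA]; first exact: mulr1.
by rewrite ffunE cbasis_orthonormal eq_sym (negPf nBA); exact: mulr0.
Qed.

Lemma cliffordM_coord s t C :
  (s * t) C = \sum_B s B * (cbasis R B * t) C.
Proof.
rewrite {1}(cliffordE s) mulr_suml sum_ffunE; apply: eq_bigr => B _.
by rewrite cscaleAl ffunE.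
Qed.

Lemma cliffordM_coordr s t C :
  (s * t) C = \sum_B t B * (s * cbasis R B) C.
Proof.
rewrite {1}(cliffordE t) mulr_sumr sum_ffunE; apply: eq_bigr => B _.
by rewrite cscaleAr ffunE.
Qed.

Lemma lactE s v C : lact s v C = \sum_A (s * cbasis R A) C *: v A.
Proof.
rewrite ffunE; apply: eq_bigr => A _; rewrite cliffordM_coord scaler_suml.
by apply: eq_bigr => B _; rewrite mulrC.
Qed.

Lemma ractE v s C : ract v s C = \sum_A (cbasis R A * s) C *: v A.
Proof.
rewrite ffunE; apply: eq_bigr => A _; rewrite cliffordM_coordr scaler_suml.
by apply: eq_bigr => B _; rewrite mulrC.
Qed.

(** Both module actions send the component [w B] to [w B] tensored with a
    Clifford number [M B]; this treats them at once. *)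
Lemma hinner_actr (M : {set 'I_d} -> clifford R d) v w w' :
  (forall C, w' C = \sum_B M B C *: w B) ->
  << v, w' >> = \sum_A \sum_B ip (v A) (w B) *: (cconj (cbasis R A) * M B).
Proof.
move=> w'E; rewrite /hinner; apply: eq_bigr => A _.
transitivity (\sum_C \sum_B (M B C * ip (v A) (w B)) *:
                 (cconj (cbasis R A) * cbasis R C)).
  apply: eq_bigr => C _; rewrite w'E ip_sumr // scaler_suml.
  by apply: eq_bigr => B _; rewrite ipZr.
rewrite exchange_big; apply: eq_bigr => B _ /=.
rewrite [M B in RHS]cliffordE mulr_sumr scaler_sumr; apply: eq_bigr => C _.
by rewrite cscaleAr scalerA mulrC.
Qed.

Lemma hinnerC v w : << w, v >> = cconj << v, w >>.
Proof.
rewrite /hinner cconj_sum exchange_big; apply: eq_bigr => A _ /=.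
rewrite cconj_sum; apply: eq_bigr => B _.
by rewrite cconjZ cconjM cconjK (ipC ip_inner).
Qed.

Lemma hinner_lact s v w : << v, lact s w >> = << lact (cconj s) v, w >>.
Proof.
rewrite (hinnerC w) (hinner_actr _ (lactE s w)) (hinner_actr _ (lactE _ v)).
rewrite cconj_sum exchange_big; apply: eq_bigr => B _.
rewrite cconj_sum; apply: eq_bigr => A _.
by rewrite cconjZ !cconjM !cconjK mulrA (ipC ip_inner).
Qed.

Lemma hinner_ractr s v w : << v, ract w s >> = << v, w >> * s.
Proof.
rewrite (hinner_actr _ (ractE w s)) /hinner mulr_suml; apply: eq_bigr => A _.
by rewrite mulr_suml; apply: eq_bigr => B _; rewrite cscaleAl mulrA.
Qed.

Lemma hinner_ractl s v w : << ract v s, w >> = cconj s * << v, w >>.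
Proof. by rewrite hinnerC hinner_ractr cconjM -hinnerC. Qed.

Lemma hinnerDr u v w : << u, v + w >> = << u, v >> + << u, w >>.
Proof.
rewrite /hinner -big_split; apply: eq_bigr => A _ /=.
rewrite -big_split; apply: eq_bigr => B _ /=.
by rewrite ffunE ipDr // scalerDl.
Qed.

Lemma hinnerZr a v w : << v, a *: w >> = a *: << v, w >>.
Proof.
rewrite /hinner scaler_sumr; apply: eq_bigr => A _.
rewrite scaler_sumr; apply: eq_bigr => B _.
by rewrite ffunE ipZr // scalerA.
Qed.

Lemma hinnerDl u v w : << u + v, w >> = << u, w >> + << v, w >>.
Proof. by rewrite hinnerC hinnerDr cconjD -!hinnerC. Qed.

Lemma hinnerZl a v w : << a *: v, w >> = a *: << v, w >>.
Proof. by rewrite hinnerC hinnerZr cconjZ -!hinnerC. Qed.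

Lemma hinner0r v : << v, 0 >> = 0.
Proof. by rewrite -(scale0r 0) hinnerZr scale0r. Qed.

Lemma hinner0l v : << 0, v >> = 0.
Proof. by rewrite -(scale0r 0) hinnerZl scale0r. Qed.

Lemma hinnerNr v w : << v, - w >> = - << v, w >>.
Proof. by rewrite -scaleN1r hinnerZr scaleN1r. Qed.

Lemma hinnerNl v w : << - v, w >> = - << v, w >>.
Proof. by rewrite -scaleN1r hinnerZl scaleN1r. Qed.

Lemma rinner_hnorm v : rinner v v = hnorm v ^+ 2.
Proof.
rewrite /hnorm sqr_sqrtr ?sumr_ge0 //.
by apply: eq_bigr => A _; rewrite ipxx.
Qed.

Lemma hnorm_ge0 v : 0 <= hnorm v.
Proof. exact: sqrtr_ge0. Qed.

Lemma hnorm0_eq0 v : hnorm v = 0 -> v = 0.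
Proof.
move=> v0; have : \sum_A `|v A| ^+ 2 = 0.
  transitivity (rinner v v); first by apply: eq_bigr => A _; rewrite ipxx.
  by rewrite rinner_hnorm v0 expr0n.
move/eqP; rewrite psumr_eq0 => [/allP v0A|A _]; last exact: sqr_ge0.
apply/ffunP => A; have := v0A A (mem_index_enum A).
by rewrite sqrf_eq0 normr_eq0 => /eqP ->; rewrite ffunE.
Qed.

Lemma hnorm00 : hnorm (0 : V) = 0.
Proof.
apply/eqP; rewrite -sqrf_eq0 -rinner_hnorm /rinner big1 // => A _.
by rewrite ffunE ip0l.
Qed.

Lemma hinner_injl v w : (forall u, << v, u >> = << w, u >>) -> v = w.
Proof.
move=> vw; apply/eqP; rewrite -subr_eq0; apply/eqP/hnorm0_eq0/eqP.
rewrite -sqrf_eq0 -rinner_hnorm -hinner_real hinnerDl hinnerNl vw subrr.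
by rewrite ffunE.
Qed.

Lemma hinner_injr v w : (forall u, << u, v >> = << u, w >>) -> v = w.
Proof. by move=> vw; apply: hinner_injl => u; rewrite hinnerC vw -hinnerC. Qed.

Lemma rinnerDl u v w : rinner (u + v) w = rinner u w + rinner v w.
Proof. by rewrite -!hinner_real hinnerDl ffunE. Qed.

Lemma rinnerZl a v w : rinner (a *: v) w = a * rinner v w.
Proof. by rewrite -!hinner_real hinnerZl ffunE. Qed.

Lemma rinner0l w : rinner 0 w = 0.
Proof. by rewrite -(scale0r 0) rinnerZl mul0r. Qed.

Lemma rinnerC v w : rinner v w = rinner w v.
Proof. by apply: eq_bigr => A _; rewrite (ipC ip_inner). Qed.

Lemma hnormsqD v w :
  hnorm (v + w) ^+ 2 = hnorm v ^+ 2 + 2 * rinner v w + hnorm w ^+ 2.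
Proof.
rewrite -!rinner_hnorm rinnerDl !(rinnerC _ (v + w)) !rinnerDl (rinnerC w v).
by lra.
Qed.

Lemma hnormZ a v : hnorm (a *: v) = `|a| * hnorm v.
Proof.
apply/eqP; rewrite -(eqrXn2 (n := 2)) ?mulr_ge0 ?hnorm_ge0 //.
by rewrite -rinner_hnorm rinnerZl rinnerC rinnerZl mulrA exprMn rinner_hnorm
  real_normK ?num_real.
Qed.

Lemma rinner_le_hnorm v w : rinner v w <= hnorm v * hnorm w.
Proof.
have H (a b : R) : 2 * (a * b) * rinner v w <= 
    b ^+ 2 * hnorm v ^+ 2 + a ^+ 2 * hnorm w ^+ 2.
  have := sqr_ge0 (hnorm (b *: v - a *: w)).
  rewrite hnormsqD -scaleNr !hnormZ !exprMn !real_normK ?num_real //.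
  by rewrite rinnerZl rinnerC rinnerZl rinnerC; lra.
have [v0|v0] := eqVneq (hnorm v) 0.
  by rewrite (hnorm0_eq0 v0) rinner0l hnorm00 mul0r.
have [w0|w0] := eqVneq (hnorm w) 0.
  by rewrite (hnorm0_eq0 w0) rinnerC rinner0l hnorm00 mulr0.
have nv : 0 < hnorm v by rewrite lt_def v0 hnorm_ge0.
have nw : 0 < hnorm w by rewrite lt_def w0 hnorm_ge0.
have := H (hnorm v) (hnorm w).
have -> : hnorm w ^+ 2 * hnorm v ^+ 2 + hnorm v ^+ 2 * hnorm w ^+ 2 =
  2 * (hnorm v * hnorm w) * (hnorm v * hnorm w) by ring.
by rewrite ler_pM2l // mulr_gt0 // mulr_gt0.
Qed.

Lemma ler_hnormD v w : hnorm (v + w) <= hnorm v + hnorm w.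
Proof.
rewrite -(ler_pXn2r (n := 2)) ?nnegrE ?addr_ge0 ?hnorm_ge0 //.
by rewrite hnormsqD sqrrD; have := rinner_le_hnorm v w; lra.
Qed.

End HilbertModule.

(** * Adjoints of right-linear operators and of resolvents *)

Section Adjoints.
Variables (R : realType) (d : nat) (VR : completeNormedModType R).
Variable ip : VR -> VR -> R.
Hypothesis ip_inner : inner_product ip.
Local Notation V := (hmodule VR d).
Local Notation "<< v , w >>" := (hinner ip v w).
Implicit Types (u v w : V) (s : clifford R d) (T S P A B : V -> V).

(** As a relation, adjointness also makes sense for operators whose
    boundedness is not known, such as integrands and Riemann sums. *)
Definition adjoint_pair A B := forall v w, << B w, v >> = << w, A v >>.

Lemma adjoint_pairC A B : adjoint_pair A B -> adjoint_pair B A.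
Proof. by move=> AB v w; rewrite (hinnerC ip_inner) -AB -(hinnerC ip_inner). Qed.

Lemma adjoint_pair_unique A B B' :
  adjoint_pair A B -> adjoint_pair A B' -> B = B'.
Proof.
move=> AB AB'; apply/funext => w; apply: (hinner_injl ip_inner) => v.
by rewrite AB AB'.
Qed.

Lemma adjoint_pair_add A B : adjoint_pair A B -> {morph B : v w / v + w}.
Proof.
move=> AB v w; apply: (hinner_injl ip_inner) => u.
by rewrite AB !hinnerDl // !AB.
Qed.

Lemma adjoint_pair_ract A B s v :
  adjoint_pair A B -> B (ract v s) = ract (B v) s.
Proof.
move=> AB; apply: (hinner_injl ip_inner) => u.
by rewrite AB !hinner_ractl // AB.
Qed.

(** [|B w|^2] is the real part of [<< w, A (B w) >>], at most
    [|w| M |B w|]. *)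
Lemma adjoint_pair_opnorm A B M :
  adjoint_pair A B -> opnorm_le A M -> opnorm_le B M.
Proof.
move=> AB AM w; have := hnorm_ge0 (B w); rewrite le_eqVlt => /predU1P[<-|Bw0].
  exact: le_trans (hnorm_ge0 _) (AM w).
rewrite -(ler_pM2r Bw0) -expr2 -(rinner_hnorm ip_inner) -hinner_real // AB hinner_real //.
apply: le_trans (rinner_le_hnorm ip_inner _ _) _.
by rewrite mulrAC [X in _ <= X]mulrC ler_wpM2l ?hnorm_ge0.
Qed.

Lemma adjoint_pair_bounded A B : adjoint_pair A B -> bounded_op A -> bounded_op B.
Proof.
move=> AB [_ _ [M AM]]; split=> [|v s|]; first exact: adjoint_pair_add AB.
  exact: adjoint_pair_ract AB.
by exists M; exact: adjoint_pair_opnorm AB AM.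
Qed.

Lemma ract_creal (a : R) v : ract v (creal d a) = a *: v.
Proof.
apply/ffunP => C; rewrite ractE (bigD1 C) //= crealMr !ffunE eqxx big1.
  by rewrite addr0 -[a *: 1]/(a * 1) mulr1.
move=> B nBC; rewrite crealMr !ffunE eq_sym (negPf nBC).
by rewrite -[a *: 0]/(a * 0) mulr0 scale0r.
Qed.

Lemma bounded_opZ T a v : bounded_op T -> T (a *: v) = a *: T v.
Proof. by case=> _ TR _; rewrite -!ract_creal TR. Qed.

Lemma bounded_opD T v w : bounded_op T -> T (v + w) = T v + T w.
Proof. by case. Qed.

Lemma bounded_op0 T : bounded_op T -> T 0 = 0.
Proof. by move=> Tb; rewrite -{1}(scale0r 0) bounded_opZ // scale0r. Qed.

Lemma bounded_opB T v w : bounded_op T -> T (v - w) = T v - T w.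
Proof.
by move=> Tb; rewrite bounded_opD // -scaleN1r bounded_opZ // scaleN1r.
Qed.

Lemma bounded_op_sum T (I : Type) (r : seq I) (Q : pred I) (F : I -> V) :
  bounded_op T ->
  T (\sum_(i <- r | Q i) F i) = \sum_(i <- r | Q i) T (F i).
Proof.
move=> Tb; apply: (big_morph T) => [v w|]; first exact: bounded_opD.
exact: bounded_op0.
Qed.

(** Riesz representation of [x |-> rinner w (T (x e_C))] on [VR] gives the
    component [C] of [S w], and summing over [C] shows that [S] is adjoint to
    [T] for the real inner product.  As [T] is right linear, replacing [v] by
    [v s] shows that [<< S w, v >> s] and [<< w, T v >> s] have the same real
    part for every [s]. *)
Lemma adjoint_pair_exists T : bounded_op T -> exists S, adjoint_pair T S.
Proof.
move=> Tb; have [_ TR [M TM]] := Tb.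
pose delta C (x : VR) : V := [ffun B => if B == C then x else 0].
have deltaD C x y : delta C (x + y) = delta C x + delta C y.
  by apply/ffunP => B; rewrite !ffunE; case: ifP; rewrite ?addr0.
have deltaZ C a x : delta C (a *: x) = a *: delta C x.
  by apply/ffunP => B; rewrite !ffunE; case: ifP; rewrite ?scaler0.
have hnorm_delta C x : hnorm (delta C x) = `|x|.
  rewrite /hnorm (bigD1 C) //= ffunE eqxx big1 => [|B nBC].
    by rewrite addr0 sqrtr_sqr normr_id.
  by rewrite ffunE (negPf nBC) normr0 expr0n.
have sum_delta v : v = \sum_C delta C (v C).
  apply/ffunP => B; rewrite sum_ffunE (bigD1 B) //= ffunE eqxx big1 ?addr0 //.
  by move=> C nCB; rewrite ffunE eq_sym (negPf nCB).
have riesz w C : exists y, forall x, ip y x = rinner ip w (T (delta C x)).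
  apply: (riesz_representation ip_inner (M := hnorm w * M)) => [x y|a x|x].
  - by rewrite deltaD bounded_opD // !(rinnerC ip_inner w) rinnerDl.
  - by rewrite deltaZ bounded_opZ // !(rinnerC ip_inner w) rinnerZl.
  apply: le_trans (rinner_le_hnorm ip_inner _ _) _.
  by rewrite -mulrA ler_wpM2l ?hnorm_ge0 // (le_trans (TM _)) // hnorm_delta.
have /choice [S ST] : forall w, exists u, 
    forall C x, ip (u C) x = rinner ip w (T (delta C x)).
  move=> w; have [y yw] := choice (riesz w).
  by exists [ffun C => y C] => C x; rewrite ffunE.
have rST v w : rinner ip (S w) v = rinner ip w (T v).
  rewrite [in RHS](sum_delta v) bounded_op_sum // (rinnerC ip_inner w).
  rewrite (big_morph (fun u => rinner ip u w)
    (fun u v => rinnerDl ip_inner u v w) (rinner0l ip_inner w)).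
  by apply: eq_bigr => C _; rewrite rinnerC // ST.
exists S => v w; apply: mul_real_inj => s.
by rewrite -!hinner_ractr // -TR !hinner_real.
Qed.

Lemma adjointP T : bounded_op T ->
  bounded_op (adjoint ip T) /\ adjoint_pair T (adjoint ip T).
Proof.
move=> Tb; have [S TS] := adjoint_pair_exists Tb.
apply: (@xgetI _ _ [set S | bounded_op S /\ adjoint_pair T S] S).
by split=> //; exact: adjoint_pair_bounded TS Tb.
Qed.

Lemma bounded_adjoint T : bounded_op T -> bounded_op (adjoint ip T).
Proof. by case/adjointP. Qed.

Lemma adjoint_pair_adjoint T : bounded_op T -> adjoint_pair T (adjoint ip T).
Proof. by case/adjointP. Qed.

Lemma adjoint_pairE T S : bounded_op T -> adjoint_pair T S -> adjoint ip T = S.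
Proof. by move=> /adjointP[_]; exact: adjoint_pair_unique. Qed.

Lemma adjointK T : bounded_op T -> adjoint ip (adjoint ip T) = T.
Proof.
move=> Tb; apply: adjoint_pairE; first exact: bounded_adjoint.
exact/adjoint_pairC/adjoint_pair_adjoint.
Qed.

Lemma adjoint_pair0 : adjoint_pair (fun=> 0) (fun=> 0).
Proof. by move=> v w; rewrite hinner0l // hinner0r. Qed.

Lemma adjoint_pairD A B A' B' : adjoint_pair A B -> adjoint_pair A' B' ->
  adjoint_pair (fun v => A v + A' v) (fun v => B v + B' v).
Proof. by move=> AB AB' v w; rewrite hinnerDl // hinnerDr // AB AB'. Qed.

Lemma adjoint_pairZ a A B : adjoint_pair A B ->
  adjoint_pair (fun v => a *: A v) (fun v => a *: B v).
Proof. by move=> AB v w; rewrite hinnerZl // hinnerZr // AB. Qed.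

Lemma adjoint_pairB A B A' B' : adjoint_pair A B -> adjoint_pair A' B' ->
  adjoint_pair (fun v => A v - A' v) (fun v => B v - B' v).
Proof.
by move=> AB AB' v w; rewrite hinnerDl // hinnerDr // hinnerNl // hinnerNr // AB AB'.
Qed.

Lemma adjoint_pair_comp A B A' B' : adjoint_pair A B -> adjoint_pair A' B' ->
  adjoint_pair (fun v => A (A' v)) (fun v => B' (B v)).
Proof. by move=> AB AB' v w; rewrite AB' AB. Qed.

Lemma adjoint_pair_id : adjoint_pair id id.
Proof. by []. Qed.

Lemma adjoint_pair_sum (I : Type) (r : seq I) (F G : I -> V -> V) :
  (forall i, adjoint_pair (F i) (G i)) ->
  adjoint_pair (fun v => \sum_(i <- r) F i v) (fun v => \sum_(i <- r) G i v).
Proof.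
move=> FG; elim: r => [|i r IH] v w.
  by rewrite !big_nil hinner0l // hinner0r.
by rewrite !big_cons hinnerDl // hinnerDr // FG IH.
Qed.

Lemma adjoint_pair_lact s : adjoint_pair (lact s) (lact (cconj s)).
Proof. by move=> v w; rewrite hinner_lact. Qed.

Lemma adjoint_pair_Qop T S (p : paravector R d) :
  adjoint_pair T S -> adjoint_pair (Qop T p) (Qop S p).
Proof.
move=> TS; apply: adjoint_pairD; last exact/adjoint_pairZ/adjoint_pair_id.
by apply: adjoint_pairB; [exact: adjoint_pair_comp|exact: adjoint_pairZ].
Qed.

Lemma inverse_op_unique T P P' : inverse_op T P -> inverse_op T P' -> P = P'.
Proof.
move=> [_ TP _] [_ _ PT']; apply/funext => v.
by rewrite -[in LHS](PT' v) TP.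
Qed.

Lemma inverse_op_adjoint A B P :
  adjoint_pair A B -> inverse_op A P -> inverse_op B (adjoint ip P).
Proof.
move=> AB [Pb AP PA]; have PP' := adjoint_pair_adjoint Pb.
split=> [|v|v]; first exact: bounded_adjoint.
  by apply: (hinner_injl ip_inner) => u; rewrite PP' AB PA.
by apply: (hinner_injl ip_inner) => u; rewrite AB PP' AP.
Qed.

Lemma S_spectrum_adjoint_pair T S :
  adjoint_pair T S -> S_spectrum T = S_spectrum S.
Proof.
move=> TS; congr (~` _); apply/seteqP; split=> p [P QP]; exists (adjoint ip P).
  exact/(inverse_op_adjoint _ QP)/adjoint_pair_Qop.
exact/(inverse_op_adjoint _ QP)/adjoint_pair_Qop/adjoint_pairC.
Qed.

Lemma QinvE T (p : paravector R d) P : inverse_op (Qop T p) P -> Qinv T p = P.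
Proof.
move=> QP; apply: xget_unique => // P' QP'; exact: inverse_op_unique QP.
Qed.

Lemma Qinv_default T (p : paravector R d) :
  (forall P, ~ inverse_op (Qop T p) P) -> Qinv T p = fun=> 0.
Proof. exact: xgetPN. Qed.

(** If the inverse exists for one of the two operators, its adjoint is the
    inverse for the other one; if not, both are the zero operator. *)
Lemma adjoint_pair_Qinv T S (p : paravector R d) :
  adjoint_pair T S -> adjoint_pair (Qinv T p) (Qinv S p).
Proof.
move=> TS; have QTS := adjoint_pair_Qop p TS.
have [[P QP]|noP] := pselect (exists P, inverse_op (Qop T p) P).
  rewrite (QinvE QP) (QinvE (inverse_op_adjoint QTS QP)).
  by apply: adjoint_pair_adjoint; case: QP.
rewrite !Qinv_default; first exact: adjoint_pair0.
  move=> P QP; apply: noP; exists (adjoint ip P).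
  exact: inverse_op_adjoint (adjoint_pairC QTS) QP.
by move=> P QP; apply: noP; exists P.
Qed.

Lemma Qinv_comm T (p : paravector R d) v :
  bounded_op T -> Qinv T p (T v) = T (Qinv T p v).
Proof.
move=> Tb; have [[P QP]|noP] := pselect (exists P, inverse_op (Qop T p) P).
  rewrite (QinvE QP); case: QP => _ TP PT.
  have QT u : Qop T p (T u) = T (Qop T p u).
    by rewrite /Qop (bounded_opD _ _ Tb) (bounded_opB _ _ Tb) !(bounded_opZ _ _ Tb).
  by rewrite -[in LHS](PT v) -QT TP.
by rewrite Qinv_default ?bounded_op0 // => P QP; apply: noP; exists P.
Qed.

Lemma Qinv_pconj T (p : paravector R d) : Qinv T (pconj p) = Qinv T p.
Proof.
rewrite /Qinv; suff -> : Qop T (pconj p) = Qop T p by [].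
apply/funext => v; rewrite /Qop /pnormsq /=.
by congr (_ - _ + (_ + _) *: _); apply: eq_bigr => i _; rewrite mxE sqrrN.
Qed.

Lemma pv_pconj (p : paravector R d) : pv (pconj p) = cconj (pv p).
Proof.
rewrite /pv cconjD cconj_creal cconj_sum; congr (_ + _); apply: eq_bigr => i _.
rewrite cconjZ cconj_cbasis mxE /= cinv_diag cards1 expr1.
by rewrite scaleNr scaleN1r scalerN.
Qed.

(** The adjoint of the term [Qinv S p (lact (cconj p) v)] is
    [lact p (Qinv T p v)], and that of [S (Qinv S p v)] is [Qinv T p (T v)],
    where the two factors commute. *)
Lemma adjoint_pair_resolvent T S (p : paravector R d) :
  bounded_op T -> adjoint_pair T S ->
  adjoint_pair (SR_resolvent T (pconj p)) (SL_resolvent S p).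
Proof.
move=> Tb TS; have QTS := adjoint_pair_Qinv p TS.
rewrite /SR_resolvent /SL_resolvent Qinv_pconj pv_pconj cconjK.
apply: adjoint_pairB; first exact: adjoint_pair_comp (adjoint_pair_lact _) QTS.
have -> : (fun v => T (Qinv T p v)) = (fun v => Qinv T p (T v)).
  by apply/funext => v; rewrite Qinv_comm.
exact: adjoint_pair_comp.
Qed.

End Adjoints.

(** * Operator-valued integrals *)

Section OperatorIntegral.
Variables (R : realType) (d : nat) (VR : completeNormedModType R).
Variable ip : VR -> VR -> R.
Hypothesis ip_inner : inner_product ip.
Local Notation V := (hmodule VR d).
Implicit Types (u v w : V) (I : V -> V) (F G : R -> V -> V).

Lemma ractD u v s : ract (u + v) s = ract u s + ract v s.
Proof.
apply: (hinner_injr ip_inner) => w.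
by rewrite hinnerDr // !hinner_ractr // hinnerDr // mulrDl.
Qed.

Lemma ractZ a v s : ract (a *: v) s = a *: ract v s.
Proof.
apply: (hinner_injr ip_inner) => w.
by rewrite hinnerZr // !hinner_ractr // hinnerZr // cscaleAl.
Qed.

Lemma bounded_op_cst0 : bounded_op (fun=> 0 : V).
Proof.
split=> [u v|v s|]; first by rewrite addr0.
  by rewrite -(scale0r 0) ractZ !scale0r.
by exists 0 => v; rewrite (hnorm00 _ ip_inner) mul0r.
Qed.

Lemma bounded_op_add A B : bounded_op A -> bounded_op B ->
  bounded_op (fun v : V => A v + B v).
Proof.
move=> [AD AR [a Aa]] [BD BR [b Bb]]; split=> [u v|v s|].
- by rewrite AD BD addrACA.
- by rewrite AR BR ractD.
exists (a + b) => v /=; apply: le_trans (ler_hnormD ip_inner _ _) _.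
by rewrite mulrDl lerD.
Qed.

Lemma bounded_op_scale c A : bounded_op A -> bounded_op (fun v : V => c *: A v).
Proof.
move=> [AD AR [a Aa]]; split=> [u v|v s|].
- by rewrite AD scalerDr.
- by rewrite AR ractZ.
by exists (`|c| * a) => v; rewrite (hnormZ ip_inner) -mulrA ler_wpM2l.
Qed.

Lemma bounded_op_bigsum (X : Type) (r : seq X) (A : X -> V -> V) :
  (forall x, bounded_op (A x)) -> bounded_op (fun v => \sum_(x <- r) A x v).
Proof.
move=> Ab; elim: r => [|x r IH].
  rewrite [X in bounded_op X](_ : _ = fun=> 0); first exact: bounded_op_cst0.
  by apply/funext => v; rewrite big_nil.
rewrite [X in bounded_op X](_ : _ = fun v => A x v + \sum_(y <- r) A y v).
  exact: bounded_op_add.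
by apply/funext => v; rewrite big_cons.
Qed.

Lemma tagged_partition_itv n (t xi : nat -> R) mesh i :
  tagged_partition n t xi mesh -> (i < n)%N -> 0 <= xi i <= 1.
Proof.
move=> [t0 tn tP] ltin.
have t_le j : (j < n)%N -> t j <= t j.+1.
  by move=> /tP[/le_trans le1 /le1].
have t_ge0 j : (j <= n)%N -> 0 <= t j.
  elim: j => [|j IH] ltjn; first by rewrite t0.
  exact: le_trans (IH (ltnW ltjn)) (t_le _ ltjn).
have t_le1 j : (j <= n)%N -> t (n - j)%N <= 1.
  elim: j => [|j IH] ltjn; first by rewrite subn0 tn.
  apply: le_trans (IH (ltnW ltjn)).
  by rewrite -(subnSK ltjn) t_le // ltn_subrL /= (leq_ltn_trans _ ltjn).
have [t_xi xi_t _] := tP _ ltin; apply/andP; split.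
  exact: le_trans (t_ge0 _ (ltnW ltin)) t_xi.
by apply: le_trans xi_t _; have := t_le1 (n - i.+1)%N (leq_subr _ _); rewrite subKn.
Qed.

Lemma tagged_partition_exists (mesh : R) : 0 < mesh ->
  exists n (t : nat -> R), tagged_partition n t t mesh.
Proof.
move=> mesh0; pose n := (Num.truncn mesh^-1).+1.
have n0 : n%:R != 0 :> R by rewrite pnatr_eq0.
exists n, (fun i => i%:R / n%:R); split=> [||i _]; first by rewrite mul0r.
  by rewrite divff.
split=> //; first by rewrite ler_pM2r ?invr_gt0 ?ltr0n // ler_nat.
rewrite -mulrBl -natrB // subSnn mul1r -[mesh]invrK ltf_pV2 ?posrE ?invr_gt0 ?ltr0n //.
exact: truncnS_gt.
Qed.

(** A tagged partition fine enough for both [I] and [I'] exists, and its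
    Riemann sum is close to both. *)
Lemma is_op_integral_unique F I I' :
  is_op_integral F I -> is_op_integral F I' -> I = I'.
Proof.
move=> [_ FI] [_ FI']; apply/funext => v; apply/eqP; rewrite -subr_eq0.
apply/eqP/(hnorm0_eq0 ip_inner); set c := hnorm _.
apply/eqP; rewrite eq_le hnorm_ge0 andbT leNgt; apply/negP => c0.
have v1 : 0 < hnorm v + 1 by have := hnorm_ge0 v; lra.
have e0 : 0 < c / (2 * (hnorm v + 1)) by rewrite divr_gt0 ?mulr_gt0.
have [m m0 FIm] := FI _ e0; have [m' m'0 FIm'] := FI' _ e0.
have [|n [t tP]] := tagged_partition_exists (mesh := Num.min m m').
  by rewrite lt_min m0.
have [tm tm'] : tagged_partition n t t m /\ tagged_partition n t t m'.
  by case: tP => ? ? H; split; split=> // i /H[? ?]; rewrite lt_min => /andP[].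
have := FIm' _ _ _ tm' v; have := FIm _ _ _ tm v.
set s := \sum_(i < n) _ => sI sI'.
have : c <= hnorm (s - I' v) + hnorm (s - I v).
  rewrite -[hnorm (s - I v)]mul1r -normrN1 -(hnormZ ip_inner) scaleN1r opprB.
  by apply: le_trans (ler_hnormD ip_inner _ _); rewrite addrC addrA subrK.
have : c / (2 * (hnorm v + 1)) * hnorm v < c / 2.
  by rewrite invfM mulrA -mulrA gtr_pMr ?divr_gt0 // ltr_pdivrMl // mulr1; lra.
by lra.
Qed.

Lemma is_op_integral_congr F G I : (forall t, 0 <= t <= 1 -> F t = G t) ->
  is_op_integral F I -> is_op_integral G I.
Proof.
move=> FG [Ib FI]; split=> // eps /FI[mesh mesh0 FIm]; exists mesh => // n t xi tP v.
suff <- : \sum_(i < n) (t i.+1 - t i) *: F (xi i) v =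
          \sum_(i < n) (t i.+1 - t i) *: G (xi i) v by exact: FIm.
by apply: eq_bigr => i _; rewrite FG // (tagged_partition_itv tP).
Qed.

Lemma op_integral_congr F G : (forall t, 0 <= t <= 1 -> F t = G t) ->
  op_integral F = op_integral G.
Proof.
move=> FG; congr xget; apply/seteqP; split=> I; apply: is_op_integral_congr => //.
by move=> t /FG.
Qed.

Lemma op_integralE F I : is_op_integral F I -> op_integral F = I.
Proof.
by move=> FI; apply: xget_unique => // I' FI'; exact: is_op_integral_unique FI.
Qed.

Lemma op_integral_default F :
  (forall I, ~ is_op_integral F I) -> op_integral F = fun=> 0.
Proof. exact: xgetPN. Qed.

Lemma bounded_op_integral F : bounded_op (op_integral F).
Proof.
have [[I FI]|noI] := pselect (exists I, is_op_integral F I).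
  by rewrite (op_integralE FI); case: FI.
rewrite op_integral_default; first exact: bounded_op_cst0.
by move=> I FI; apply: noI; exists I.
Qed.

Lemma is_op_integral_adjoint F G I :
  (forall t, 0 <= t <= 1 -> adjoint_pair ip (F t) (G t)) ->
  is_op_integral F I -> is_op_integral G (adjoint ip I).
Proof.
move=> FG [Ib FI]; split=> [|eps /FI[mesh mesh0 FIm]]; first exact: bounded_adjoint.
exists mesh => // n t xi tP; apply: (adjoint_pair_opnorm ip_inner) (FIm n t xi tP).
apply: (adjoint_pairB ip_inner) (adjoint_pair_adjoint ip_inner Ib).
apply: (adjoint_pair_sum ip_inner) => i; apply: (adjoint_pairZ ip_inner).
by apply/FG/(tagged_partition_itv tP).
Qed.

(** When neither function is integrable, both integrals are the zero
    operator, which is its own adjoint. *)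
Lemma adjoint_pair_op_integral F G :
  (forall t, 0 <= t <= 1 -> adjoint_pair ip (F t) (G t)) ->
  adjoint_pair ip (op_integral F) (op_integral G).
Proof.
move=> FG; have [[I FI]|noI] := pselect (exists I, is_op_integral F I).
  rewrite (op_integralE FI) (op_integralE (is_op_integral_adjoint FG FI)).
  by apply: (adjoint_pair_adjoint ip_inner); case: FI.
rewrite !op_integral_default; first exact: adjoint_pair0.
  move=> I GI; apply: noI; exists (adjoint ip I).
  by apply: is_op_integral_adjoint GI => t /FG; exact: adjoint_pairC.
by move=> I FI; apply: noI; exists I.
Qed.

End OperatorIntegral.

(** * Conjugation on slices *)

Section Slices.
Variables (R : realType) (d : nat).
Implicit Types (s : paravector R d) (J : 'rV[R]_d) (z : R * R)
  (U : set (paravector R d)) (f : paravector R d -> clifford R d).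

Lemma pconjK : involutive (@pconj R d).
Proof. by case=> a v; rewrite /pconj /= opprK. Qed.

Lemma slice_opp J z : slice (- J) z = pconj (slice J z).
Proof. by rewrite /slice /pconj /= scalerN. Qed.

Lemma sphere_opp J : sphere J -> sphere (- J).
Proof.
rewrite /sphere /= => <-; apply: eq_bigr => i _.
by rewrite mxE sqrrN.
Qed.

Lemma im_norm_slice J z : sphere J -> im_norm (slice J z) = `|z.2|.
Proof.
rewrite /sphere /im_norm /= => J1.
under eq_bigr do rewrite mxE exprMn.
by rewrite -mulr_sumr J1 mulr1 sqrtr_sqr.
Qed.

Lemma plane_domain_slice U J z : axially_symmetric U -> sphere J ->
  U (slice J z) -> plane_domain U z.
Proof.
move=> Uax J1 Uz K K1.
have [z2|z2] := leP 0 z.2.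
  have := Uax _ _ Uz K1; rewrite im_norm_slice // ger0_norm //.
have := Uax _ _ Uz (sphere_opp K1); rewrite im_norm_slice // ltr0_norm //.
by rewrite /slice /= scalerN scaleNr opprK.
Qed.

(** The conjugate of [r] lies on the sphere of [r]: it is the point with
    direction [- Im r / |Im r|], or [r] itself when [Im r = 0]. *)
Lemma axially_symmetric_pconj U s : axially_symmetric U -> U (pconj s) <-> U s.
Proof.
move=> Uax; suff H r : U r -> U (pconj r) by split=> [/H|/H //]; rewrite pconjK.
move=> Ur; pose n := im_norm r.
have n0 : 0 <= \sum_i r.2 0 i ^+ 2 by apply: sumr_ge0 => i _; exact: sqr_ge0.
have [nE|n_neq0] := eqVneq n 0.
  suff -> : pconj r = r by [].
  suff r20 : r.2 = 0 by case: (r) r20 => a v /= ->; rewrite /pconj oppr0.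
  apply/rowP => i; rewrite mxE.
  have /eqP : \sum_i r.2 0 i ^+ 2 = 0.
    by apply/eqP; rewrite eq_le n0 andbT -sqrtr_eq0; apply/eqP.
  rewrite psumr_eq0 => [/allP/(_ i (mem_index_enum i))|j _]; last exact: sqr_ge0.
  by rewrite sqrf_eq0 => /eqP.
have J1 : sphere (- (n^-1 *: r.2)).
  apply: sphere_opp; rewrite /sphere /=.
  under eq_bigr do rewrite mxE exprMn.
  by rewrite -mulr_sumr -(sqr_sqrtr n0) -exprMn mulVf ?expr1n.
have := Uax _ _ Ur J1.
by rewrite /slice /pconj /= scalerN scalerA divff ?scale1r.
Qed.

Lemma pvJ J : pv (0, J) = \sum_i J 0 i *: cgen R i.
Proof. by rewrite /pv /= /creal scale0r add0r. Qed.

Lemma pv_slice J z : pv (slice J z) = creal d z.1 + z.2 *: pv (0, J).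
Proof.
rewrite pvJ /pv /= scaler_sumr; congr (_ + _).
by apply: eq_bigr => i _; rewrite mxE scalerA.
Qed.

Lemma pv_opp J : pv (0, - J) = - pv (0, J).
Proof.
rewrite !pvJ -sumrN.
by apply: eq_bigr => i _; rewrite mxE scaleNr.
Qed.

Lemma cconj_pvJ J : cconj (pv (0, J)) = - pv (0, J).
Proof. by rewrite -pv_pconj -pv_opp. Qed.

(** Both sides are [J] times the conjugate of the velocity, in either order,
    and [J] commutes with the elements of its slice. *)
Lemma dsJ_opp J gam t : dsJ (- J) gam t = cconj (dsJ J gam t).
Proof.
rewrite /dsJ !cconjM cconjN cconj_pvJ -pv_pconj -slice_opp pv_opp !opprK.
rewrite pv_slice pv_opp; move: (pv (0, J)) => j.
rewrite mulrDl mulrDr crealM crealMr scalerN.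
by rewrite mulrN mulNr cscaleAl cscaleAr.
Qed.

Lemma fsharpK : involutive (@fsharp R d).
Proof.
by move=> f; apply/funext => s; rewrite /fsharp cconjK pconjK.
Qed.

Lemma continuous_pconj : continuous (@pconj R d).
Proof.
move=> s.
have s1 : (r.1 @[r --> s] --> s.1) by exact: cvg_fst.
have s2 : (- r.2 @[r --> s] --> - s.2) by apply: cvgN; exact: cvg_snd.
exact: cvg_pair s1 s2.
Qed.

Lemma nbhs_pconj U s : nbhs s U -> nbhs (pconj s) (@pconj R d @^-1` U).
Proof.
move=> Us; apply: continuous_pconj; rewrite /= pconjK; exact: Us.
Qed.

Lemma closure_pconj U s :
  axially_symmetric U -> closure U (pconj s) <-> closure U s.
Proof.
move=> Uax.
suff H r : closure U (pconj r) -> closure U r.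
  by split=> [/H //|h]; apply: H; rewrite (pconjK s).
move=> Ur B /nbhs_pconj /Ur [q [Uq Bq]].
by exists (pconj q); split=> //; apply/axially_symmetric_pconj.
Qed.

Lemma interior_pconj U s : axially_symmetric U -> U° (pconj s) <-> U° s.
Proof.
move=> Uax; suff H r : U° (pconj r) -> U° r.
  by split=> [/H //|h]; apply: H; rewrite (pconjK s).
rewrite /interior => /nbhs_pconj; rewrite (pconjK r).
by apply: filterS => q /= /(axially_symmetric_pconj _ Uax).
Qed.

(** The points of the slices of [J] and [- J] with the same plane coordinates
    are conjugate, and conjugation is a homeomorphism preserving [U], hence its
    closure and interior. *)
Lemma admissible_opp (K U' U : set (paravector R d)) J Gam :
  admissible K U' U J Gam -> admissible K U' U (- J) Gam.
Proof.
move=> [[Uo Ub Uax] KU UU' J1 [Gjordan Gbd Gin Gout]].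
have clE z : closure U (slice (- J) z) <-> closure U (slice J z).
  by rewrite slice_opp; exact: closure_pconj.
have intE z : U° (slice (- J) z) <-> U° (slice J z).
  by rewrite slice_opp; exact: interior_pconj.
split; [by split|exact: KU|exact: UU'|exact: sphere_opp|].
split=> [|z|z|z]; first exact: Gjordan.
- by rewrite -Gbd /setD /= clE intE.
- rewrite slice_opp axially_symmetric_pconj; [exact: Gin|exact: Uax].
by rewrite clE; exact: Gout.
Qed.

Lemma admissible_curve (K U' U : set (paravector R d)) J Gam gam t :
  admissible K U' U J Gam -> axially_symmetric U' ->
  (exists2 i, (i < size Gam)%N & gam = nth (fun=> 0) Gam i) ->
  0 <= t <= 1 -> plane_domain U' (gam t).
Proof.
move=> [_ _ UU' J1 [_ Gbd _ _]] U'ax [i ltiG ->] t01.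
apply: (plane_domain_slice U'ax J1); apply: UU'.
by have [] : (closure U `\` U°) (slice J (nth (fun=> 0) Gam i t)) by
  apply/Gbd; exists i, t.
Qed.

Lemma derivable_opp (g : R * R -> R) z v :
  derivable (fun w => - g w) z v <-> derivable g z v.
Proof.
have gE : - (fun w => - g w) = g by apply/funext => w; exact: opprK.
by split=> h; have := derivableN h; [rewrite gE|exact].
Qed.

(** Without differentiability both directional derivatives have the default
    value [0]; an unconditional identity makes continuity of the partial
    derivatives transfer from pointwise hypotheses, with no neighbourhood
    involved. *)
Lemma derive_opp (g : R * R -> R) z v :
  'D_v (fun w => - g w) z = - 'D_v g z.
Proof.
have [gz|gz] := pselect (derivable g z v); first exact: deriveN.
have gz' : ~ derivable (fun w => - g w) z v by move/derivable_opp.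
by rewrite /derive (dvgP gz) (dvgP gz'); exact/esym/oppr0.
Qed.

Lemma derivable_signM (g : R * R -> R) n z v :
  derivable g z v -> derivable (fun w => (-1) ^+ n * g w) z v.
Proof.
move=> gz; rewrite -signr_odd; case: odd; rewrite ?expr0 ?expr1.
  by under eq_fun do rewrite mulN1r; apply/derivable_opp.
by under eq_fun do rewrite mul1r.
Qed.

Lemma derive_signM (g : R * R -> R) n z v :
  'D_v (fun w => (-1) ^+ n * g w) z = (-1) ^+ n * 'D_v g z.
Proof.
rewrite -signr_odd; case: odd; rewrite ?expr0 ?expr1.
  by under eq_fun do rewrite mulN1r; rewrite derive_opp mulN1r.
by under eq_fun do rewrite mul1r; rewrite mul1r.
Qed.

Lemma cconj_coordE (g : R * R -> clifford R d) (A : {set 'I_d}) :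
  (fun w => cconj (g w) A) = (fun w => (-1) ^+ cinv A A * g w A).
Proof. by apply/funext => w; rewrite cconjE. Qed.

Lemma dx_cconj (g : R * R -> clifford R d) (A : {set 'I_d}) :
  dx (fun w => cconj (g w)) A = (fun z => (-1) ^+ cinv A A * dx g A z).
Proof. by apply/funext => z; rewrite /dx cconj_coordE derive_signM. Qed.

Lemma dy_cconj (g : R * R -> clifford R d) (A : {set 'I_d}) :
  dy (fun w => cconj (g w)) A = (fun z => (-1) ^+ cinv A A * dy g A z).
Proof. by apply/funext => z; rewrite /dy cconj_coordE derive_signM. Qed.

Lemma C1_on_cconj (D : set (R * R)) (g : R * R -> clifford R d) :
  C1_on D g -> C1_on D (fun z => cconj (g z)).
Proof.
move=> Cg z A Dz; have [d1 d2 c1 c2] := Cg z A Dz.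
split; rewrite ?cconj_coordE ?dx_cconj ?dy_cconj; try exact: derivable_signM.
  by apply: cvgM; [exact: cvg_cst|exact: c1].
by apply: cvgM; [exact: cvg_cst|exact: c2].
Qed.

Lemma slice_pair_cconj U (f0 f1 : R * R -> clifford R d) :
  slice_pair U f0 f1 ->
  slice_pair U (fun z => cconj (f0 z)) (fun z => cconj (f1 z)).
Proof.
move=> [C0 C1 sym CR]; split; [exact: C1_on_cconj|exact: C1_on_cconj| |].
  by move=> z /sym[-> ->]; rewrite cconjN.
move=> z A Dz; have [CR1 CR2] := CR z A Dz.
by rewrite !dx_cconj !dy_cconj CR1 CR2 mulrN.
Qed.

(** Conjugation reverses products, so it moves the unit [J] to the other side
    of [f1]; the sign it produces is cancelled by that of the conjugation of
    the argument. *)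
Lemma SH_R_fsharp U f : SH_L U f -> SH_R U (fsharp f).
Proof.
move=> [f0 [f1 [f01 fE]]].
exists (fun z => cconj (f0 z)), (fun z => cconj (f1 z)).
split=> [|z J Uz J1]; first exact: slice_pair_cconj.
rewrite /fsharp -slice_opp fE //; last exact: sphere_opp.
by rewrite cconjD cconjM cconj_pvJ pv_opp opprK.
Qed.

Lemma SH_L_fsharp U f : SH_R U f -> SH_L U (fsharp f).
Proof.
move=> [f0 [f1 [f01 fE]]].
exists (fun z => cconj (f0 z)), (fun z => cconj (f1 z)).
split=> [|z J Uz J1]; first exact: slice_pair_cconj.
rewrite /fsharp -slice_opp fE //; last exact: sphere_opp.
by rewrite cconjD cconjM cconj_pvJ pv_opp opprK.
Qed.

Lemma intrinsic_fsharp U f z J : intrinsic U f -> plane_domain U z -> sphere J ->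
  fsharp f (slice J z) = f (slice J z).
Proof.
move=> [f0 [f1 [_ fE]]] Uz J1.
rewrite /fsharp -slice_opp !fE //; last exact: sphere_opp.
by rewrite cconjD cconjM !cconj_creal cconj_pvJ pv_opp opprK crealM crealMr.
Qed.

End Slices.

(** * The functional calculi of T and of its adjoint *)

Section Calculus.
Variables (R : realType) (d : nat) (VR : completeNormedModType R).
Variable ip : VR -> VR -> R.
Hypothesis ip_inner : inner_product ip.
Local Notation V := (hmodule VR d).
Variable U' : set (paravector R d).
Implicit Types (T S : V -> V) (f g : paravector R d -> clifford R d)
  (J : 'rV[R]_d) (Gam : seq (R -> R * R)) (E : set (V -> V)).

Lemma bounded_left_integral T f J Gam : bounded_op (left_integral T f J Gam).
Proof.
apply: (bounded_op_scale ip_inner); apply: (bounded_op_bigsum ip_inner) => gam.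
exact: (bounded_op_integral ip_inner).
Qed.

Lemma bounded_right_integral T f J Gam : bounded_op (right_integral T f J Gam).
Proof.
apply: (bounded_op_scale ip_inner); apply: (bounded_op_bigsum ip_inner) => gam.
exact: (bounded_op_integral ip_inner).
Qed.

(** The pointwise form of the theorem: the order of the three factors of the
    integrand is reversed and each of them is replaced by its adjoint. *)
Lemma adjoint_pair_integral T S f J Gam :
  bounded_op T -> adjoint_pair ip T S ->
  adjoint_pair ip (right_integral T (fsharp f) (- J) Gam)
                  (left_integral S f J Gam).
Proof.
move=> Tb TS; apply: (adjoint_pairZ ip_inner).
apply: (adjoint_pair_sum ip_inner) => gam.
apply: (adjoint_pair_op_integral ip_inner) => t _.
rewrite slice_opp dsJ_opp /fsharp pconjK => v w.
rewrite (adjoint_pair_resolvent ip_inner _ Tb TS).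
by rewrite !(hinner_lact ip_inner) !cconjK.
Qed.

Lemma left_values_adjoint T S f : bounded_op T -> adjoint_pair ip T S ->
  left_values U' S f = adjoint ip @` right_values U' T (fsharp f).
Proof.
move=> Tb TS; have specTS := S_spectrum_adjoint_pair ip_inner TS.
apply/seteqP; split=> [_ [U [J [Gam [adm ->]]]]|_ [_ [U [J [Gam [adm ->]]]] <-]].
  exists (right_integral T (fsharp f) (- J) Gam).
    by exists U, (- J), Gam; rewrite specTS; split; [exact: admissible_opp|].
  apply: (adjoint_pairE ip_inner); first exact: bounded_right_integral.
  exact: adjoint_pair_integral.
exists U, (- J), Gam; rewrite -specTS; split; first exact: admissible_opp.
apply: (adjoint_pairE ip_inner); first exact: bounded_right_integral.
by rewrite -[in X in adjoint_pair _ X](opprK J); exact: adjoint_pair_integral.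
Qed.

Lemma left_values_bounded T f A : left_values U' T f A -> bounded_op A.
Proof. by move=> [U [J [Gam [_ ->]]]]; exact: bounded_left_integral. Qed.

Lemma right_values_bounded T f A : right_values U' T f A -> bounded_op A.
Proof. by move=> [U [J [Gam [_ ->]]]]; exact: bounded_right_integral. Qed.

Lemma adjoint_imageK E : (forall A, E A -> bounded_op A) ->
  adjoint ip @` (adjoint ip @` E) = E.
Proof.
move=> Eb; apply/seteqP; split=> [_ [_ [A EA <-] <-]|A EA].
  by rewrite (adjointK ip_inner (Eb _ EA)).
exists (adjoint ip A); first by exists A.
exact: (adjointK ip_inner (Eb _ EA)).
Qed.

(** [left_values_adjoint] with the roles of [T] and [S] exchanged, read backwards
    through the involution [adjoint]. *)
Lemma right_values_adjoint T S f : bounded_op T -> adjoint_pair ip T S ->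
  right_values U' S f = adjoint ip @` left_values U' T (fsharp f).
Proof.
move=> Tb TS; have Sb := adjoint_pair_bounded ip_inner TS Tb.
rewrite (left_values_adjoint _ Sb (adjoint_pairC ip_inner TS)) fsharpK.
rewrite adjoint_imageK // => A; exact: right_values_bounded.
Qed.

Lemma the_op1 (A : V -> V) : the_op [set A] = A.
Proof. by apply: xget_unique => // B /seteqP[_ /(_ B erefl)]. Qed.

(** On bounded operators [adjoint] is injective, so [E] and its image are
    singletons together; otherwise both sides are the zero operator. *)
Lemma the_op_adjoint E : (forall A, E A -> bounded_op A) ->
  the_op (adjoint ip @` E) = adjoint ip (the_op E).
Proof.
move=> Eb; have [[A EA]|noA] := pselect (exists A, E = [set A]).
  by rewrite EA image_set1 !the_op1.
have -> : the_op E = fun=> 0 by apply: xgetPN => A EA; apply: noA; exists A.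
rewrite (adjoint_pairE ip_inner (bounded_op_cst0 _ ip_inner) (adjoint_pair0 ip_inner)).
apply: xgetPN => B EB; apply: noA; exists (adjoint ip B).
by rewrite -(adjoint_imageK Eb) EB image_set1.
Qed.

Lemma eq_sum_op_integral Gam (F G : (R -> R * R) -> R -> V -> V) v :
  (forall i t, (i < size Gam)%N -> 0 <= t <= 1 ->
     F (nth (fun=> 0) Gam i) t = G (nth (fun=> 0) Gam i) t) ->
  \sum_(gam <- Gam) op_integral (F gam) v =
  \sum_(gam <- Gam) op_integral (G gam) v.
Proof.
move=> FG; rewrite !(big_nth (fun=> 0)); apply: eq_big_nat => i /andP[_ ltiG].
by rewrite (@op_integral_congr _ _ _ _ (G (nth (fun=> 0) Gam i))) // => t /(FG i t ltiG).
Qed.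

Lemma left_integral_congr T f g K U J Gam :
  axially_symmetric U' -> admissible K U' U J Gam ->
  (forall z, plane_domain U' z -> f (slice J z) = g (slice J z)) ->
  left_integral T f J Gam = left_integral T g J Gam.
Proof.
move=> U'ax adm fg; apply/funext => v; rewrite /left_integral.
apply: (congr1 ( *:%R _)); apply: eq_sum_op_integral => i t ltiG t01.
have zU' : plane_domain U' (nth (fun=> 0) Gam i t).
  by apply: admissible_curve adm U'ax _ t01; exists i.
by rewrite (fg _ zU').
Qed.

Lemma right_integral_congr T f g K U J Gam :
  axially_symmetric U' -> admissible K U' U J Gam ->
  (forall z, plane_domain U' z -> f (slice J z) = g (slice J z)) ->
  right_integral T f J Gam = right_integral T g J Gam.
Proof.
move=> U'ax adm fg; apply/funext => v; rewrite /right_integral.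
apply: (congr1 ( *:%R _)); apply: eq_sum_op_integral => i t ltiG t01.
have zU' : plane_domain U' (nth (fun=> 0) Gam i t).
  by apply: admissible_curve adm U'ax _ t01; exists i.
by rewrite (fg _ zU').
Qed.

Lemma left_values_congr T f g : axially_symmetric U' ->
  (forall z J, plane_domain U' z -> sphere J -> f (slice J z) = g (slice J z)) ->
  left_values U' T f = left_values U' T g.
Proof.
have sub h k : axially_symmetric U' ->
    (forall z J, plane_domain U' z -> sphere J -> h (slice J z) = k (slice J z)) ->
    left_values U' T h `<=` left_values U' T k.
  move=> U'ax hk _ [U [J [Gam [adm ->]]]]; exists U, J, Gam; split; first exact: adm.
  apply: (left_integral_congr T U'ax adm) => z Uz; apply: hk Uz _.
  by case: adm.
move=> U'ax fg; apply/seteqP; split; apply: sub U'ax _ => z J Uz J1.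
  exact: fg.
exact/esym/fg.
Qed.

Lemma right_values_congr T f g : axially_symmetric U' ->
  (forall z J, plane_domain U' z -> sphere J -> f (slice J z) = g (slice J z)) ->
  right_values U' T f = right_values U' T g.
Proof.
have sub h k : axially_symmetric U' ->
    (forall z J, plane_domain U' z -> sphere J -> h (slice J z) = k (slice J z)) ->
    right_values U' T h `<=` right_values U' T k.
  move=> U'ax hk _ [U [J [Gam [adm ->]]]]; exists U, J, Gam; split; first exact: adm.
  apply: (right_integral_congr T U'ax adm) => z Uz; apply: hk Uz _.
  by case: adm.
move=> U'ax fg; apply/seteqP; split; apply: sub U'ax _ => z J Uz J1.
  exact: fg.
exact/esym/fg.
Qed.

End Calculus.

Theorem theorem4p4 (R : realType) (d : nat) (d_ge1 : (1 <= d)%N)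
    (VR : completeNormedModType R) (ip : VR -> VR -> R)
    (ip_inner : inner_product ip)
    (T : hmodule VR d -> hmodule VR d) (T_bounded : bounded_op T)
    (U' : set (paravector R d)) (U'_open : open U')
    (U'_axial : axially_symmetric U') (T_spec : S_spectrum T `<=` U')
    (f : paravector R d -> clifford R d) :
  [/\ SH_L U' f ->
        SH_R U' (fsharp f) /\
        left_calculus U' (adjoint ip T) f =
          adjoint ip (right_calculus U' T (fsharp f)),
      SH_R U' f ->
        SH_L U' (fsharp f) /\
        right_calculus U' (adjoint ip T) f =
          adjoint ip (left_calculus U' T (fsharp f)) &
      intrinsic U' f ->
        intrinsic_calculus U' (adjoint ip T) f =
          adjoint ip (intrinsic_calculus U' T f)].
Proof.
have TT' := adjoint_pair_adjoint ip_inner T_bounded.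
have leftE := left_values_adjoint ip_inner U' _ T_bounded TT'.
have rightE := right_values_adjoint ip_inner U' _ T_bounded TT'.
split=> [fL|fR|fI].
- split; first exact: SH_R_fsharp.
  rewrite /left_calculus leftE; apply: (the_op_adjoint ip_inner) => A.
  exact: (right_values_bounded ip_inner).
- split; first exact: SH_L_fsharp.
  rewrite /right_calculus rightE; apply: (the_op_adjoint ip_inner) => A.
  exact: (left_values_bounded ip_inner).
rewrite /intrinsic_calculus leftE rightE.
have fsharpE z J : plane_domain U' z -> sphere J ->
    fsharp f (slice J z) = f (slice J z) by exact: intrinsic_fsharp.
rewrite (left_values_congr T U'_axial fsharpE).
rewrite (right_values_congr T U'_axial fsharpE).
rewrite -image_setU setUC; apply: (the_op_adjoint ip_inner) => A [].
  exact: (left_values_bounded ip_inner).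
exact: (right_values_bounded ip_inner).
Qed.
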